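(* Suppose $X\in\mathcal{M}^e$, $Z\in\overline{\mathcal{M}}^q$ and $\dim(T_X\mathcal{M}^e)=\dim(\mathcal{H}_Z\overline{\mathcal{M}}^q)=d$. Then both $\operatorname{Hess}f(X)$ and $\overline{\operatorname{Hess}h([Z])}$ have $d$ eigenvalues. Moreover, if $\mathcal{L}:\mathcal{H}_Z\overline{\mathcal{M}}^q\to T_X\mathcal{M}^e$ is a linear bijection satisfying $$\overline{\operatorname{Hess}h([Z])}[\theta_Z,\theta_Z]=\operatorname{Hess}f(X)[\mathcal{L}(\theta_Z),\mathcal{L}(\theta_Z)]\qquad\forall\,\theta_Z\in\mathcal{H}_Z\overline{\mathcal{M}}^q$$ and $$\alpha\,\bar g_Z(\theta_Z,\theta_Z)\le g_X(\mathcal{L}(\theta_Z),\mathcal{L}(\theta_Z))\le\beta\,\bar g_Z(\theta_Z,\theta_Z)\qquad\forall\,\theta_Z\in\mathcal{H}_Z\overline{\mathcal{M}}^q$$ for some $0\le\alpha\le\beta$, then for $k=1,\dots,d$, $\lambda_k(\overline{\operatorname{Hess}h([Z])})$ is sandwiched between $\alpha\lambda_k(\operatorname{Hess}f(X))$ and $\beta\lambda_k(\operatorname{Hess}f(X))$, where $\lambda_k$ denotes the $k$-th largest eigenvalue.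
   Context: $\mathcal{M}^e$ is a $d$-dimensional Riemannian embedded submanifold of a Riemannian manifold, with metric $g_X$ at $X$, and $f:\mathcal{M}^e\to\mathbb{R}$ is twice continuously differentiable (the restriction of a function on the ambient manifold). $\overline{\mathcal{M}}^q$ is a smooth manifold of dimension $d+m$ with a Riemannian metric $\bar g$, and $\bar\ell:\overline{\mathcal{M}}^q\to\mathcal{M}^e$ is a surjective submersion. Let $\bar h=f\circ\bar\ell$, let $Z_1\sim Z_2$ iff $\bar\ell(Z_1)=\bar\ell(Z_2)$, and let $\mathcal{M}^q=\overline{\mathcal{M}}^q/\!\sim$ be the quotient manifold with quotient map $\pi$ and $h([Z])=\bar h(Z)$ the induced function. At each $Z$, $\mathcal{H}_Z\overline{\mathcal{M}}^q\subset T_Z\overline{\mathcal{M}}^q$ is a chosen horizontal space, complementary to the tangent space of the fiber $[Z]$; the horizontal lift at $Z$ of $\theta_{[Z]}\in T_{[Z]}\mathcal{M}^q$ is the unique $\theta_Z\in\mathcal{H}_Z\overline{\mathcal{M}}^q$ with $\mathrm{D}\pi(Z)[\theta_Z]=\theta_{[Z]}$. $\mathcal{M}^q$ is a Riemannian quotient manifold: $g_{[Z]}(\eta_{[Z]},\theta_{[Z]}):=\bar g_Z(\eta_Z,\theta_Z)$ does not depend on the representative $Z$ and defines the metric of $\mathcal{M}^q$. $\operatorname{Hess}f(X)$ is the Riemannian Hessian, a self-adjoint linear map on $(T_X\mathcal{M}^e,g_X)$, with bilinear form $\operatorname{Hess}f(X)[\xi,\eta]=g_X(\operatorname{Hess}f(X)[\xi],\eta)$.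 $\overline{\operatorname{Hess}h([Z])}$ is the lift of the Riemannian Hessian of $h$ to $(\mathcal{H}_Z\overline{\mathcal{M}}^q,\bar g_Z)$, a self-adjoint map with bilinear form $\overline{\operatorname{Hess}h([Z])}[\theta_Z,\eta_Z]=\operatorname{Hess}h([Z])[\theta_{[Z]},\eta_{[Z]}]$. ''$a$ is sandwiched between $b$ and $c$'' means $\min\{b,c\}\le a\le\max\{b,c\}$. *)

(* Defs.v *)
From HB Require Import structures.
From mathcomp Require Import all_boot all_order all_algebra.
From mathcomp Require Import all_classical all_reals all_analysis.

Set Implicit Arguments.
Unset Strict Implicit.
Unset Printing Implicit Defensive.

Import Order.TTheory GRing.Theory Num.Theory.
Import numFieldNormedType.Exports.

Local Open Scope classical_set_scope.
Local Open Scope ring_scope.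

(* Vectors of R^n are rows, and matrices act on them by right multiplication,
   as in [jacobian]. *)

Definition bform (R : realType) (n : nat) (A : 'M[R]_n) (u v : 'rV[R]_n) : R :=
  (u *m A *m v^T) 0 0.

Definition basis_vec (R : realType) (n : nat) (i : 'I_n) : 'rV[R]_n :=
  delta_mx 0 i.
Arguments basis_vec R {n} i.

(* Meaningful for open U: all partial derivatives of order at most k exist and
   are continuous on U. *)
Fixpoint Ck_on (R : realType) (n k : nat) (U : set 'rV[R]_n)
    (f : 'rV[R]_n -> R) : Prop :=
  {in U, continuous f} /\
  if k is k'.+1 then
    forall i : 'I_n, (forall x, U x -> derivable f x (basis_vec R i)) /\
                     Ck_on k' U ('D_(basis_vec R i) f)
  else True.

Definition smooth_on (R : realType) (n : nat) (U : set 'rV[R]_n)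
    (f : 'rV[R]_n -> R) : Prop := forall k, Ck_on k U f.

(* A smooth structure is presented by an atlas that contains one distinguished
   chart [chart p], defined on [chart_dom p], around every point p; the values
   of [chart p] off [chart_dom p] and of [chart_inv p] off [chart_img p] are
   irrelevant. *)
Record manifold (R : realType) (n : nat) (M : topologicalType) := Manifold {
  chart_dom : M -> set M;
  chart : M -> M -> 'rV[R]_n;
  chart_inv : M -> 'rV[R]_n -> M;
  manifold_hausdorff : hausdorff_space M;
  manifold_second_countable : @second_countable M;
  chart_dom_open : forall p, open (chart_dom p);
  chart_dom_center : forall p, chart_dom p p;
  chart_img_open : forall p, open (chart p @` chart_dom p);
  chartK : forall p q, chart_dom p q -> chart_inv p (chart p q) = q;
  chart_continuous : forall p, {in chart_dom p, continuous (chart p)};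
  chart_inv_continuous :
    forall p, {in chart p @` chart_dom p, continuous (chart_inv p)};
  chart_compat : forall p q (i : 'I_n),
    smooth_on (chart p @` (chart_dom p `&` chart_dom q))
              (fun x => chart q (chart_inv p x) 0 i)
}.

Definition chart_img (R : realType) (n : nat) (M : topologicalType)
    (S : manifold R n M) (p : M) : set 'rV[R]_n :=
  chart S p @` chart_dom S p.

(* Tangent vectors at p are represented by their coordinates in the
   distinguished chart at p. *)
Definition tangent (R : realType) (n : nat) (M : topologicalType)
    (S : manifold R n M) (p : M) : vectType R := 'rV[R]_n.

Definition Ck_fun (R : realType) (n : nat) (M : topologicalType)
    (S : manifold R n M) (k : nat) (f : M -> R) : Prop :=
  forall p, Ck_on k (chart_img S p) (f \o chart_inv S p).

Section Maps.
Variables (R : realType) (n1 n2 : nat) (M1 M2 : topologicalType).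
Variables (S1 : manifold R n1 M1) (S2 : manifold R n2 M2).
Implicit Type F : M1 -> M2.

Definition smooth_map F : Prop :=
  continuous F /\
  forall p q (i : 'I_n2),
    smooth_on (chart S1 p @` (chart_dom S1 p `&` F @^-1` chart_dom S2 q))
              (fun x => chart S2 q (F (chart_inv S1 p x)) 0 i).

Definition differential F (p : M1) :
    'Hom(tangent S1 p, tangent S2 (F p)) :=
  linfun ('d (chart S2 (F p) \o F \o chart_inv S1 p) (chart S1 p p)).

Definition submersion F : Prop :=
  smooth_map F /\ forall p, limg (differential F p) = fullv.

Definition embedding F : Prop :=
  [/\ smooth_map F,
      forall p, lker (differential F p) = 0%VS,
      injective F &
      forall U : set M1, open U -> exists2 V : set M2, open V & U = F @^-1` V].

End Maps.

(* The velocities at p of the smooth curves that stay in A. *)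
Definition tangent_set (R : realType) (n : nat) (M : topologicalType)
    (S : manifold R n M) (A : set M) (p : M) : set (tangent S p) :=
  [set v | exists gamma : R -> M,
    [/\ gamma 0 = p,
        v = derive1 (chart S p \o gamma) 0 &
        \forall t \near (0 : R),
          [/\ A (gamma t), chart_dom S p (gamma t) &
              forall k, derivable (derive1n k (chart S p \o gamma)) t 1]]].
Arguments tangent_set {R n M} S A p.

(* For g_ q the Gram matrix of an inner product on T_q M in the distinguished
   chart at q, the matrix of the same inner product in the coordinate frame of
   the chart at p, at the point with coordinates x. *)
Definition gram_in (R : realType) (n : nat) (M : topologicalType)
    (S : manifold R n M) (g_ : M -> 'M[R]_n) (p : M) (x : 'rV[R]_n) : 'M[R]_n :=
  let q := chart_inv S p x in
  let J := jacobian (chart S q \o chart_inv S p) x in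
  J *m g_ q *m J^T.

Record riemannian_metric (R : realType) (n : nat) (M : topologicalType)
    (S : manifold R n M) := RiemannianMetric {
  gram : M -> 'M[R]_n;
  gram_sym : forall p, (gram p)^T = gram p;
  gram_pos : forall p (u : 'rV[R]_n), u != 0 -> 0 < bform (gram p) u u;
  gram_smooth : forall p (i j : 'I_n),
    smooth_on (chart_img S p) (fun x => gram_in S gram p x i j)
}.

Definition inner (R : realType) (n : nat) (M : topologicalType)
    (S : manifold R n M) (g : riemannian_metric S) (p : M)
    (u v : tangent S p) : R :=
  bform (gram g p) u v.

Section LocalGeometry.
Variables (R : realType) (n : nat) (G : 'rV[R]_n -> 'M[R]_n).

(* G(grad f, v) = 'D_v f. *)
Definition local_grad (f : 'rV[R]_n -> R) (x : 'rV[R]_n) : 'rV[R]_n :=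
  (\row_l 'D_(basis_vec R l) f x) *m invmx (G x).

(* Koszul's formula for constant vector fields:
   2 G(Gamma(u, v), w) = 'D_u G (v, w) + 'D_v G (u, w) - 'D_w G (u, v). *)
Definition christoffel (x u v : 'rV[R]_n) : 'rV[R]_n :=
  2^-1 *: (\row_l (bform ('D_u G x) v (basis_vec R l)
                   + bform ('D_v G x) u (basis_vec R l)
                   - bform ('D_(basis_vec R l) G x) u v)) *m invmx (G x).

Definition levi_civita (V : 'rV[R]_n -> 'rV[R]_n) (x u : 'rV[R]_n) : 'rV[R]_n :=
  'D_u V x + christoffel x u (V x).

End LocalGeometry.

(* Hess f(p)[u] = nabla_u grad f, computed in the distinguished chart at p.
   [linfun] is total: it yields the linear map wherever the argument is
   linear, as it is for f of class C^2. *)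
Definition hess (R : realType) (n : nat) (M : topologicalType)
    (S : manifold R n M) (g : riemannian_metric S) (f : M -> R) (p : M) :
    'End(tangent S p) :=
  let G := gram_in S (gram g) p in
  linfun (levi_civita G (local_grad G (f \o chart_inv S p)) (chart S p p)).

Definition hess_form (R : realType) (n : nat) (M : topologicalType)
    (S : manifold R n M) (g : riemannian_metric S) (f : M -> R) (p : M)
    (u v : tangent S p) : R :=
  inner g (hess g f p u) v.

Section Quotient.
Variables (T U : topologicalType) (l : T -> U).

Definition fiber_rel : rel T := [rel z1 z2 | l z1 == l z2].

Lemma fiber_rel_equiv : equiv_class_of fiber_rel.
Proof.
split=> [z|z1 z2|z2 z1 z3]; rewrite /fiber_rel /=; first by [].
- by rewrite eq_sym.
- by move=> /eqP -> /eqP ->.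
Qed.

Canonical fiber_equiv := EquivRelPack fiber_rel_equiv.

Definition fiber_quotient : topologicalType :=
  quotient_topology {eq_quot fiber_equiv}%qT.

Definition quotient_map (z : T) : fiber_quotient :=
  (\pi_(quotient_topology {eq_quot fiber_equiv}) z)%qT.

End Quotient.

Section Horizontal.
Variables (R : realType) (d n : nat) (T U : topologicalType) (l : T -> U).
Variables (S : manifold R n T) (Sq : manifold R d (fiber_quotient l)).
Local Notation pr := (quotient_map l).

Definition is_horizontal (Z : T) (H : {vspace tangent S Z}) : Prop :=
  let V := tangent_set S (pr @^-1` [set pr Z]) Z in
  (forall v : tangent S Z, exists2 w, V w & v - w \in H) /\
  (forall v : tangent S Z, V v -> v \in H -> v = 0).

Variables (Z : T) (H : {vspace tangent S Z}).

Definition dpi_hor : 'Hom(subvs_of H, tangent Sq (pr Z)) :=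
  (differential S Sq pr Z \o linfun vsval)%VF.

(* [dpi_hor] is bijective when H is horizontal and the quotient map is a
   submersion, and its [^-1] is then its inverse. *)
Definition hor_lift : 'Hom(tangent Sq (pr Z), subvs_of H) := (dpi_hor^-1)%VF.

Definition lifted_hess (g : riemannian_metric Sq) (h : fiber_quotient l -> R) :
    'End(subvs_of H) :=
  (hor_lift \o hess g h (pr Z) \o dpi_hor)%VF.

Definition lifted_hess_form (g : riemannian_metric Sq)
    (h : fiber_quotient l -> R) (u v : subvs_of H) : R :=
  hess_form g h (dpi_hor u) (dpi_hor v).

End Horizontal.

Definition lfun_char_poly (R : realType) (E : vectType R) (phi : 'End(E)) :
    {poly R} :=
  char_poly (passmx.mxof (vbasis {: E}) (vbasis {: E}) phi).

(* The real eigenvalues in nonincreasing order, repeated according to their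
   algebraic multiplicity. *)
Definition eigenvalues (R : realType) (E : vectType R) (phi : 'End(E)) : seq R :=
  xget [::] [set s : seq R | sorted >=%R s /\
                             forall a, count_mem a s = mup a (lfun_char_poly phi)].

(* k is counted from 1. *)
Definition kth_eigenvalue (R : realType) (E : vectType R) (k : nat)
    (phi : 'End(E)) : R :=
  nth 0 (eigenvalues phi) k.-1.

Definition sandwiched (R : realType) (a b c : R) : Prop :=
  Num.min b c <= a <= Num.max b c.

(* Main.v *)
(* Both Hessians are self-adjoint, hence have orthonormal eigenbases (u_i) and
   (v_i) with nonincreasing eigenvalues.  A dimension count yields theta <> 0 in
   span(u_1, ..., u_k) with L theta in span(v_k, ..., v_d), so that
     lambda_k(lifted Hess h) |theta|^2 <= Hess h[theta, theta]
       = Hess f[L theta, L theta] <= lambda_k(Hess f) |L theta|^2,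
   and the bounds on |L theta|^2 give the upper half; the lower half is dual.

   Self-adjointness of Hess f reduces to the symmetry of the second partial
   derivatives in Koszul's formula.  For h, regularity has to be derived first:
   the quotient map has local sections (inverse function theorem), through which
   h is locally f \o ell composed with a twice differentiable map. *)

Require Import Defs.
From HB Require Import structures.
From mathcomp Require Import fingroup perm complex.
From mathcomp Require Import all_boot all_order all_algebra.
From mathcomp Require Import all_classical all_reals all_analysis.
From mathcomp Require Import ring lra.

Set Implicit Arguments.
Unset Strict Implicit.
Unset Printing Implicit Defensive.

Import Order.TTheory GRing.Theory Num.Theory.
Import numFieldNormedType.Exports.

Local Open Scope classical_set_scope.
Local Open Scope ring_scope.

(** * Self-adjoint maps of a Euclidean space *)

(** In a basis, an endomorphism becomes a matrix A acting on rows and the inner product a Gram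
    matrix B; self-adjointness then says that A *m B is symmetric. The spectral argument is run for
    such pairs, so that no orthonormal basis has to be fixed beforehand.

    The obstacle is h: it is tied to f only by its pullback to the total space, and the charts of
    the quotient are known only through the quotient map being a submersion. Regularity is therefore
    carried in a pointwise form, [twice_diff], which passes through compositions and local inverses
    and still gives symmetric second derivatives. It also yields the linearity without which the
    [linfun] in [hess] would say nothing. *)

Section Spectral.
Variable R : realType.

Lemma bformDl n (A : 'M[R]_n) u v w :
  bform A (u + v) w = bform A u w + bform A v w.
Proof. by rewrite /bform !mulmxDl mxE. Qed.

Lemma bformZl n (A : 'M[R]_n) a u w : bform A (a *: u) w = a * bform A u w.
Proof. by rewrite /bform -!scalemxAl mxE. Qed.

Lemma bformD n (A B : 'M[R]_n) u w : bform (A + B) u w = bform A u w + bform B u w.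
Proof. by rewrite /bform mulmxDr mulmxDl mxE. Qed.

Lemma bformZ n a (A : 'M[R]_n) u w : bform (a *: A) u w = a * bform A u w.
Proof. by rewrite /bform -scalemxAr -scalemxAl mxE. Qed.

Lemma bformC n (A : 'M[R]_n) u v : A^T = A -> bform A u v = bform A v u.
Proof.
(* The value is the entry of a 1x1 matrix, hence unchanged by transposition. *)
move=> symA; rewrite /bform -[LHS](mxE trmx_key (fun i j => (u *m A *m v^T) j i)).
by rewrite -/(trmx _) !trmx_mul trmxK symA mulmxA.
Qed.

Lemma bformE n (A : 'M[R]_n) u v :
  bform A u v = \sum_i \sum_j u 0 i * A i j * v 0 j.
Proof.
rewrite /bform mxE exchange_big; apply: eq_bigr => j _ /=.
by rewrite !mxE mulr_suml.
Qed.

Lemma bform_row m n (A : 'M[R]_(m, n)) (B : 'M[R]_n) u v :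
  bform (A *m B *m A^T) u v = bform B (u *m A) (v *m A).
Proof. by rewrite /bform trmx_mul !mulmxA. Qed.

Lemma bform_mull n (A B : 'M[R]_n) u v : bform (A *m B) u v = bform B (u *m A) v.
Proof. by rewrite /bform !mulmxA. Qed.

Definition posdef n (A : 'M[R]_n) := forall u, u != 0 -> 0 < bform A u u.

Lemma bform_ge0 n (A : 'M[R]_n) u :
  posdef A -> 0 <= bform A u u.
Proof.
move=> posA; have [->|/posA/ltW//] := eqVneq u 0.
by rewrite /bform !mul0mx mxE.
Qed.

Local Notation C := (complex R).

Lemma Re_mulmx_real n (v : 'rV[C]_n) (A : 'M[R]_n) :
  map_mx (@complex.Re R) (v *m map_mx (@real_complex R) A) =
  map_mx (@complex.Re R) v *m A.
Proof.
apply/rowP => j; rewrite !mxE raddf_sum; apply: eq_bigr => k _ /=.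
by rewrite !mxE; case: (v 0 k) => a b /=; rewrite mulr0 subr0.
Qed.

Lemma Im_mulmx_real n (v : 'rV[C]_n) (A : 'M[R]_n) :
  map_mx (@complex.Im R) (v *m map_mx (@real_complex R) A) =
  map_mx (@complex.Im R) v *m A.
Proof.
apply/rowP => j; rewrite !mxE raddf_sum; apply: eq_bigr => k _ /=.
by rewrite !mxE; case: (v 0 k) => a b /=; rewrite mulr0 add0r mulrC.
Qed.

(* A complex eigenvector x + i y for a + i b satisfies
   x A = a x - b y and y A = a y + b x; comparing B(x A, y) with B(x, y A)
   gives b (B(x, x) + B(y, y)) = 0. *)
Lemma selfadjoint_eigenvector n (A B : 'M[R]_n.+1) :
  B^T = B -> posdef B -> (A *m B)^T = A *m B ->
  exists (a : R) (v : 'rV[R]_n.+1), v != 0 /\ v *m A = a *: v.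
Proof.
move=> symB posB symAB.
pose AC := map_mx (@real_complex R) A.
have [c rc] : exists c, root (char_poly AC) c.
  by apply/closed_rootP; rewrite size_char_poly.
have /eigenvalueP[v vAC v0] : eigenvalue AC c by rewrite eigenvalue_root_char.
case: c {rc} vAC => a b vAC.
pose x := map_mx (@complex.Re R) v; pose y := map_mx (@complex.Im R) v.
have xA : x *m A = a *: x - b *: y.
  by rewrite -Re_mulmx_real vAC; apply/rowP => j; rewrite !mxE; case: (v 0 j).
have yA : y *m A = a *: y + b *: x.
  rewrite -Im_mulmx_real vAC; apply/rowP => j.
  by rewrite !mxE; case: (v 0 j) => ? ? /=.
have xy0 : (x != 0) || (y != 0).
  rewrite -negb_and; apply: contra v0 => /andP[/eqP x0 /eqP y0].
  apply/eqP/rowP => j; rewrite mxE.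
  move/rowP: x0 => /(_ j); move/rowP: y0 => /(_ j); rewrite !mxE.
  by case: (v 0 j) => ? ? /= -> ->.
have b0 : b = 0.
  have : bform (A *m B) x y = bform (A *m B) y x by apply: bformC.
  rewrite !bform_mull xA yA -scaleNr !bformDl !bformZl (bformC y x symB).
  move=> /addrI/eqP; rewrite -subr_eq0 mulNr -opprD -mulrDr oppr_eq0 mulf_eq0.
  case/orP => [/eqP//|]; rewrite paddr_eq0 ?bform_ge0// => /andP[y0 x0].
  by case/orP: xy0 => /posB; rewrite ?(eqP y0) ?(eqP x0) ltxx.
rewrite b0 scale0r subr0 in xA; rewrite b0 scale0r addr0 in yA.
by case/orP: xy0 => ?; [exists a, x | exists a, y].
Qed.

(** Induction on the dimension. A normalised eigenvector v is split off; A preserves its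
    B-orthogonal complement, the row space of W, because symmetry of A *m B moves A onto v. On W the
    map has matrix A' and the inner product has Gram matrix W B W^T, and this pair satisfies the
    hypotheses again. *)
Lemma spectral n (A B : 'M[R]_n) :
  B^T = B -> posdef B -> (A *m B)^T = A *m B ->
  exists (P : 'M[R]_n) (l : 'rV[R]_n),
    P *m B *m P^T = 1%:M /\ P *m A = diag_mx l *m P.
Proof.
elim: n A B => [|n IH] A B symB posB symAB.
  by exists 0, 0; split; apply/matrixP => -[].
have [a [v0 [v0_neq0 v0A]]] := selfadjoint_eigenvector symB posB symAB.
pose v := (Num.sqrt (bform B v0 v0))^-1 *: v0.
have vA : v *m A = a *: v by rewrite -scalemxAl v0A !scalerA mulrC.
have v1 : v *m B *m v^T = 1%:M.
  rewrite [LHS]mx11_scalar -/(bform B v v) bformZl bformC// bformZl.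
  by rewrite mulrA -invfM -expr2 sqr_sqrtr ?mulVf ?gt_eqF ?ltW ?posB.
have rkw : \rank (kermx (B *m v^T)) = n.
  rewrite mxrank_ker; suff -> : \rank (B *m v^T) = 1%N by rewrite subn1.
  apply/eqP; rewrite eqn_leq rank_leq_col lt0n mxrank_eq0.
  by apply/eqP => e; move/eqP: v1; rewrite -mulmxA e mulmx0 eq_sym oner_eq0.
have [W [Wfree Wker]] : exists W : 'M[R]_(n, n.+1),
    row_free W /\ (W :=: kermx (B *m v^T))%MS.
  (* The number of rows of [row_base] is a rank; generalising the matrix lets [rkw] turn that number
     into n. *)
  move: (row_base_free (kermx (B *m v^T))) (eq_row_base (kermx (B *m v^T))).
  by move: (row_base _); rewrite rkw => W ? ?; exists W.
have WBv : W *m (B *m v^T) = 0.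
  by apply/sub_kermxP; rewrite -Wker submx_refl.
have /submxP[A' WA] : (W *m A <= W)%MS.
  rewrite Wker; apply/sub_kermxP.
  have -> : W *m A *m (B *m v^T) = W *m (A *m B *m v^T) by rewrite !mulmxA.
  rewrite -symAB trmx_mul symB -(mulmxA B) -trmx_mul vA linearZ /=.
  by rewrite -!scalemxAr WBv scaler0.
have [|||P' [l' [P'1 P'A]]] := IH A' (W *m B *m W^T).
- by rewrite !trmx_mul trmxK symB mulmxA.
- move=> u u0; rewrite bform_row posB //.
  apply: contra u0 => /eqP uW; rewrite -(mul0mx _ W) in uW.
  by rewrite (row_free_inj Wfree uW).
- rewrite !mulmxA -WA -(mulmxA W A) !trmx_mul trmxK.
  by rewrite -(trmx_mul A B) symAB !mulmxA.
pose Q := P' *m W.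
have QBv : Q *m B *m v^T = 0 by rewrite -!mulmxA WBv mulmx0.
have vBQ : v *m B *m Q^T = 0.
  by apply: trmx_inj; rewrite !trmx_mul !trmxK symB trmx0 mulmxA QBv.
have QQ : Q *m B *m Q^T = 1%:M by rewrite trmx_mul -P'1 !mulmxA.
have QA : Q *m A = diag_mx l' *m Q by rewrite -mulmxA WA !mulmxA P'A.
exists (col_mx v Q), (row_mx a%:M l'); split.
  rewrite (@tr_col_mx _ 1 n n.+1) (@mul_col_mx _ 1 n n.+1)
    (@mul_col_row _ 1 n n.+1 1 n).
  by rewrite v1 vBQ QBv QQ -(scalar_mx_block 1 n).
rewrite (@mul_col_mx _ 1 n) (@diag_mx_row _ n 1) (@mul_block_col _ 1 n 1 n n.+1).
rewrite !mul0mx addr0 add0r QA vA.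
suff -> : diag_mx (a%:M : 'rV_1) *m v = a *: v by [].
by apply/rowP => j; rewrite mul_diag_mx !mxE eqxx.
Qed.

Definition eigen_decomposition n (A B : 'M[R]_n) (s : seq R) :=
  [/\ size s = n, sorted >=%R s &
      exists P : 'M[R]_n, P *m B *m P^T = 1%:M /\
                          P *m A = diag_mx (\row_i s`_i) *m P].

Lemma sorted_spectral n (A B : 'M[R]_n) :
  B^T = B -> posdef B -> (A *m B)^T = A *m B ->
  exists s, eigen_decomposition A B s.
Proof.
move=> symB posB symAB; have [P [l [P1 PA]]] := spectral symB posB symAB.
pose t := [tuple l 0 i | i < n].
have /tuple_permP[p sE] : perm_eq (sort_tuple >=%R t) t by rewrite perm_sort.
exists (sort_tuple >=%R t); split; first exact: size_tuple.
  by apply: sort_sorted => a b; rewrite le_total.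
have sp (i : 'I_n) : (sort_tuple >=%R t)`_i = l 0 (p i).
  by rewrite sE nth_mktuple tnth_mktuple.
exists (row_perm p P); split.
  rewrite row_permE trmx_mul !mulmxA -2!(mulmxA (perm_mx p)) P1 mulmx1.
  by rewrite tr_perm_mx -perm_mxM fingroup.mulgV perm_mx1.
rewrite row_permE -mulmxA PA -!row_permE; apply/matrixP => i j.
by rewrite !mul_diag_mx !mxE sp.
Qed.

(** P (X - A) = (X - D) P with D diagonal; taking determinants, the nonzero constant det P
    cancels. *)
Lemma char_poly_eigen_decomposition n (A B : 'M[R]_n) s :
  eigen_decomposition A B s -> char_poly A = \prod_(a <- s) ('X - a%:P).
Proof.
move=> [sz _ [P [P1 PA]]].
have Punit : P \in unitmx.
  by move: P1; rewrite -mulmxA => /mulmx1_unit[].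
pose D := diag_mx (\row_(i < n) s`_i).
have -> : char_poly A = char_poly D.
  have : \det (map_mx polyC P *m char_poly_mx A) =
         \det (char_poly_mx D *m map_mx polyC P).
    congr (\det _); rewrite mulmxBr mulmxBl -!map_mxM PA.
    by rewrite scalar_mxC.
  rewrite !det_mulmx mulrC; apply: mulIf.
  by rewrite det_map_mx polyC_eq0 -unitfE.
rewrite char_poly_trig; last by apply/diag_mx_is_trig.
rewrite (big_nth 0) sz big_mkord; apply: eq_bigr => i _.
by rewrite !mxE eqxx mulr1n.
Qed.

(** [eigenvalues] is a choice, but a nonincreasing list is determined by its multiplicities, so the
    choice is forced. *)
Lemma eigenvaluesE (E : vectType R) (phi : 'End(E)) s :
  sorted >=%R s -> lfun_char_poly phi = \prod_(a <- s) ('X - a%:P) ->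
  eigenvalues phi = s.
Proof.
move=> s_sorted phiE; apply: xget_unique => [|t [t_sorted tE]].
  by split=> // a; rewrite phiE mu_prod_XsubC.
apply: (sorted_eq (leT := >=%R)) => //.
- by move=> a b c ab bc; apply: le_trans ab.
- by move=> a b /le_anti.
by apply/allP => a _; rewrite /= tE phiE mu_prod_XsubC.
Qed.

End Spectral.

(** * Comparison of the eigenvalues of two self-adjoint maps *)

Section Sandwich.
Variable R : realType.

(** P B P^T = 1 makes B P^T the inverse of P, so x *m Q holds the coordinates of x in the
    orthonormal eigenbasis, where both forms are diagonal. *)
Lemma eigen_coordinates n (A B : 'M[R]_n) s : eigen_decomposition A B s ->
  exists Q : 'M[R]_n, forall x,
    bform B x x = \sum_i (x *m Q) 0 i ^+ 2 /\
    bform (A *m B) x x = \sum_(i < n) s`_i * (x *m Q) 0 i ^+ 2.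
Proof.
move=> [_ _ [P [P1 PA]]]; exists (B *m P^T) => x; set c := x *m _.
have -> : x = c *m P.
  by rewrite -mulmxA (mulmx1C (A := P)) ?mulmx1// mulmxA.
clearbody c; split.
  rewrite -bform_row P1 /bform mulmx1 mxE; apply: eq_bigr => i _.
  by rewrite mxE expr2.
rewrite -bform_row mulmxA PA -2!mulmxA (mulmxA P) P1 mulmx1 /bform mul_mx_diag mxE.
by apply: eq_bigr => i _; rewrite !mxE mulrAC mulrC expr2.
Qed.

(** The dimension count: k conditions from C and n - 1 - k from D are n - 1 linear equations in n
    unknowns. Arranged as columns of a square matrix they leave column k free; it is filled with
    zeros, so the determinant vanishes. *)
Lemma nonzero_common_kernel n (C D : 'M[R]_n) (k : 'I_n) :
  exists x : 'rV[R]_n, [/\ x != 0, forall j : 'I_n, (j < k)%N -> (x *m C) 0 j = 0 &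
                         forall j : 'I_n, (k < j)%N -> (x *m D) 0 j = 0].
Proof.
pose M : 'M[R]_n :=
  \matrix_(i, j) if (j < k)%N then C i j else if (k < j)%N then D i j else 0.
have /eqP/det0P[x x0 xM] : \det M = 0.
  rewrite (expand_det_col _ k) big1// => i _.
  by rewrite mxE ltnn mul0r.
exists x; split=> // j jk.
  have /rowP/(_ j) := xM; rewrite !mxE => xMj; rewrite -[RHS]xMj.
  by apply: eq_bigr => i _; rewrite mxE jk.
have /rowP/(_ j) := xM; rewrite !mxE => xMj; rewrite -[RHS]xMj.
by apply: eq_bigr => i _; rewrite mxE ltnNge (ltnW jk)/= jk.
Qed.

Lemma eigen_sandwich n1 n2 (A1 B1 : 'M[R]_n1) (A2 B2 : 'M[R]_n2)
    (L : 'M[R]_(n1, n2)) (s1 s2 : seq R) (alpha beta : R) :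
  n1 = n2 -> eigen_decomposition A1 B1 s1 -> eigen_decomposition A2 B2 s2 ->
  posdef B1 ->
  (forall x, bform (A1 *m B1) x x = bform (A2 *m B2) (x *m L) (x *m L)) ->
  (forall x, alpha * bform B1 x x <= bform B2 (x *m L) (x *m L)
                                  <= beta * bform B1 x x) ->
  forall k, (k < n1)%N -> sandwiched s1`_k (alpha * s2`_k) (beta * s2`_k).
Proof.
move=> n12; case: n2 / n12 A2 B2 L => A2 B2 L d1 d2 pos1 qE qB k0 k0n.
have [Q1 Q1E] := eigen_coordinates d1; have [Q2 Q2E] := eigen_coordinates d2.
have [[sz1 srt1 _] [sz2 srt2 _]] := (d1, d2).
pose k := Ordinal k0n; rewrite -[k0]/(val k).
have mono (s : seq R) : size s = n1 -> sorted >=%R s ->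
    forall i j : 'I_n1, (i <= j)%N -> s`_j <= s`_i.
  move=> sz srt i j ij.
  apply: (@sorted_leq_nth _ >=%R _ _ 0 s) => //=; rewrite ?inE ?sz//.
- by move=> a b c ab bc; exact: le_trans ab.
- by move=> a; exact: lexx.
rewrite /sandwiched; apply/andP; split.
(* Lower bound: x uses only eigenvectors of A1 of index at least k, and x *m L only those of A2 of
   index at most k. The upper bound exchanges the two ranges. *)
- have [x [x0 x1 x2]] := nonzero_common_kernel Q1 (L *m Q2) k.
  have qx := pos1 x x0; rewrite -(ler_pM2r qx).
  have le1 : bform (A1 *m B1) x x <= s1`_k * bform B1 x x.
    rewrite (Q1E x).1 (Q1E x).2 mulr_sumr; apply: ler_sum => i _.
    have [/x1->|ki] := ltnP i k; first by rewrite expr0n/= !mulr0.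
    by rewrite ler_wpM2r ?sqr_ge0 ?mono.
  apply: le_trans le1.
  have le2 : s2`_k * bform B2 (x *m L) (x *m L) <= bform (A1 *m B1) x x.
    rewrite qE (Q2E (x *m L)).1 (Q2E (x *m L)).2 mulr_sumr; apply: ler_sum => i _.
    have [/x2|ki] := ltnP k i; first
      by rewrite mulmxA => ->; rewrite expr0n/= !mulr0.
    by rewrite ler_wpM2r ?sqr_ge0 ?mono.
  apply: le_trans le2.
  (* Multiplying the bounds by the k-th eigenvalue of A2 keeps or reverses them according to its
     sign, so either alpha or beta is the relevant one; this is where the min comes from. *)
  have /andP[qa qb] := qB x; have [l0|l0] := leP 0 s2`_k.
    apply: (@le_trans _ _ (alpha * s2`_k * bform B1 x x)).
      by rewrite ler_pM2r// ge_min lexx.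
    by rewrite mulrAC mulrC ler_wpM2l.
  apply: (@le_trans _ _ (beta * s2`_k * bform B1 x x)).
    by rewrite ler_pM2r// ge_min lexx orbT.
  by rewrite mulrAC mulrC ler_wnM2l// ltW.
- have [x [x0 x1 x2]] := nonzero_common_kernel (L *m Q2) Q1 k.
  have qx := pos1 x x0; rewrite -(ler_pM2r qx).
  have le1 : s1`_k * bform B1 x x <= bform (A1 *m B1) x x.
    rewrite (Q1E x).1 (Q1E x).2 mulr_sumr; apply: ler_sum => i _.
    have [/x2->|ki] := ltnP k i; first by rewrite expr0n/= !mulr0.
    by rewrite ler_wpM2r ?sqr_ge0 ?mono.
  apply: (le_trans le1).
  have le2 : bform (A1 *m B1) x x <= s2`_k * bform B2 (x *m L) (x *m L).
    rewrite qE (Q2E (x *m L)).1 (Q2E (x *m L)).2 mulr_sumr; apply: ler_sum => i _.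
    have [/x1|ki] := ltnP i k; first
      by rewrite mulmxA => ->; rewrite expr0n/= !mulr0.
    by rewrite ler_wpM2r ?sqr_ge0 ?mono.
  apply: (le_trans le2).
  have /andP[qa qb] := qB x; have [l0|l0] := leP 0 s2`_k.
    apply: (@le_trans _ _ (beta * s2`_k * bform B1 x x)).
      by rewrite [leRHS]mulrAC [leRHS]mulrC ler_wpM2l.
    by rewrite ler_pM2r// le_max lexx orbT.
  apply: (@le_trans _ _ (alpha * s2`_k * bform B1 x x)).
    by rewrite [leRHS]mulrAC [leRHS]mulrC ler_wnM2l// ltW.
  by rewrite ler_pM2r// le_max lexx.
Qed.

Definition inner_product (E : vectType R) (b : E -> E -> R) :=
  [/\ forall w, linear (b^~ w), forall u v, b u v = b v u &
      forall u, u != 0 -> 0 < b u u].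

Section SelfAdjoint.
Variables (E : vectType R) (b : E -> E -> R) (ip : inner_product b).
Local Notation e := (vbasis {: E}).
Local Notation rV := (passmx.rVof e).

Definition basis_gram : 'M[R]_(\dim {: E}) := \matrix_(i, j) b e`_i e`_j.

Lemma basis_gramE u v : b u v = bform basis_gram (rV u) (rV v).
Proof.
have [blin bC _] := ip.
have bsuml (f : 'I_(\dim {: E}) -> R) w :
    b (\sum_i f i *: e`_i) w = \sum_i f i * b e`_i w.
  pose bL := GRing.isLinear.Build _ _ _ _ (b^~ w) (blin w).
  pose bl : {linear E -> R} := HB.pack (b^~ w) bL.
  by rewrite -[LHS]/(bl _) linear_sum; apply: eq_bigr => i _; rewrite linearZ.
rewrite bformE [u in LHS](coord_vbasis (memvf u)) bsuml; apply: eq_bigr => i _.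
rewrite bC [v in LHS](coord_vbasis (memvf v)) bsuml mulr_sumr.
by apply: eq_bigr => j _; rewrite !mxE (bC e`_j) mulrA mulrAC.
Qed.

Lemma basis_gram_sym : basis_gram^T = basis_gram.
Proof. by have [_ bC _] := ip; apply/matrixP => i j; rewrite !mxE bC. Qed.

Lemma basis_gram_posdef : posdef basis_gram.
Proof.
have [_ _ bpos] := ip; move=> x x0.
rewrite -(passmx.vecofK (vbasisP fullv) x) -basis_gramE bpos//.
by rewrite passmx.vecof_eq0 ?vbasisP.
Qed.

Variable phi : 'End(E).
Local Notation A := (passmx.mxof e e phi).

Lemma basis_gram_mxof u v : b (phi u) v = bform (A *m basis_gram) (rV u) (rV v).
Proof. by rewrite basis_gramE (passmx.rVof_app e (vbasisP _)) bform_mull. Qed.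

Hypothesis phi_sa : forall u v, b (phi u) v = b u (phi v).

(** Self-adjointness, tested on basis vectors, is symmetry of A *m [basis_gram]. The list found by
    [sorted_spectral] gives the roots of the characteristic polynomial in order, hence is
    [eigenvalues phi]. *)
Lemma selfadjoint_eigen_decomposition :
  eigen_decomposition A basis_gram (eigenvalues phi).
Proof.
have [s d] : exists s, eigen_decomposition A basis_gram s.
  apply: sorted_spectral; [exact: basis_gram_sym | exact: basis_gram_posdef |].
  have [_ bC _] := ip.
  apply/matrixP => i j; rewrite mxE.
  have entry (M : 'M[R]_(\dim {: E})) i' j' :
      M i' j' = bform M (rV e`_i') (rV e`_j').
    rewrite !(passmx.rVofE (vbasisP _)) bformE.
    rewrite (bigD1 i')//= [X in _ + X]big1 ?addr0 => [|l li]; last first.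
      by rewrite big1// => l' _; rewrite mxE (negPf li) andbF !mul0r.
    rewrite (bigD1 j')//= big1 ?addr0 => [|l lj]; last first.
      by rewrite [X in _ * X]mxE (negPf lj) andbF mulr0.
    by rewrite !mxE !eqxx mul1r mulr1.
  by rewrite !entry -!basis_gram_mxof phi_sa bC.
have [sz srt _] := d.
by rewrite (eigenvaluesE srt (char_poly_eigen_decomposition d)).
Qed.

Lemma size_eigenvalues_selfadjoint : size (eigenvalues phi) = \dim {: E}.
Proof. by have [] := selfadjoint_eigen_decomposition. Qed.

End SelfAdjoint.

Lemma kth_eigenvalue_sandwich (E1 E2 : vectType R)
    (b1 : E1 -> E1 -> R) (b2 : E2 -> E2 -> R) (phi1 : 'End(E1)) (phi2 : 'End(E2))
    (L : 'Hom(E1, E2)) (alpha beta : R) :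
  inner_product b1 -> inner_product b2 ->
  (forall u v, b1 (phi1 u) v = b1 u (phi1 v)) ->
  (forall u v, b2 (phi2 u) v = b2 u (phi2 v)) ->
  \dim {: E1} = \dim {: E2} ->
  (forall u, b1 (phi1 u) u = b2 (phi2 (L u)) (L u)) ->
  (forall u, alpha * b1 u u <= b2 (L u) (L u) <= beta * b1 u u) ->
  forall k, (1 <= k <= \dim {: E1})%N ->
  sandwiched (kth_eigenvalue k phi1) (alpha * kth_eigenvalue k phi2)
             (beta * kth_eigenvalue k phi2).
Proof.
move=> ip1 ip2 sa1 sa2 dimE qE qB k /andP[k1 kd].
pose e1 := vbasis {: E1}; pose e2 := vbasis {: E2}.
apply: (eigen_sandwich (L := passmx.mxof e1 e2 L) dimE
  (selfadjoint_eigen_decomposition ip1 sa1)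
  (selfadjoint_eigen_decomposition ip2 sa2) (basis_gram_posdef ip1)).
- move=> x; rewrite -(passmx.vecofK (vbasisP fullv) x).
  rewrite -(passmx.rVof_app e2 (vbasisP _)) -!basis_gram_mxof//.
- move=> x; rewrite -(passmx.vecofK (vbasisP fullv) x).
  rewrite -(passmx.rVof_app e2 (vbasisP _)) -!basis_gramE//.
- by rewrite prednK.
Qed.

End Sandwich.

(** * Differential calculus in coordinates *)

Section MatrixValued.
Variables (R : realType) (V : normedModType R).

Lemma differentiable_near_eq (W : normedModType R) (f g : V -> W) (x : V) :
  (\forall y \near x, f y = g y) -> differentiable f x -> differentiable g x.
Proof.
move=> fg df.
have gE : g \o shift x = cst (g x) + 'd f x +o_ 0 id.
  apply/eqaddoP => e e0; have [_ /eqaddoP/(_ e e0)] := (diff_locallyP x f).1 df.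
  apply: filter_app; have := fg; rewrite (near_shift 0 x) subr0.
  apply: filter_app; near=> h => fgh; rewrite /=.
  by rewrite /cst /shift /= !fctE /= -(nbhs_singleton fg) -fgh.
apply/diff_locallyP; rewrite (diff_unique (diff_continuous df) gE).
by split=> //; exact: diff_continuous df.
Unshelve. all: by end_near. Qed.

Lemma differentiable_mx m n (F : V -> 'M[R]_(m, n)) x :
  (forall i j, differentiable (fun y => F y i j) x) -> differentiable F x.
Proof.
move=> dF.
have -> : F = \sum_i \sum_j (fun y => F y i j *: delta_mx i j).
  apply/funext => y; rewrite [LHS]matrix_sum_delta fct_sumE.
  by apply: eq_bigr => i _; rewrite fct_sumE.
apply: differentiable_sum => i; apply: differentiable_sum => j.
exact: differentiableZl.
Qed.

Lemma differentiable_entry m n (F : V -> 'M[R]_(m, n)) x i j :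
  differentiable F x -> differentiable (fun y => F y i j) x.
Proof.
move=> dF.
apply: (@differentiable_comp _ _ _ _ F (fun N : 'M[R]_(m, n) => N i j)) => //.
exact: differentiable_coord.
Qed.

Lemma derive_entry m n (F : V -> 'M[R]_(m, n)) x v i j :
  differentiable F x -> ('D_v F x) i j = 'D_v (fun y => F y i j) x.
Proof. by move=> /diff_derivable dF; rewrite derive_mx ?mxE. Qed.

Lemma differentiable_fsum (I : finType) (P : pred I) (W : normedModType R)
    (f : I -> V -> W) x :
  (forall i, P i -> differentiable (f i) x) ->
  differentiable (fun y => \sum_(i | P i) f i y) x.
Proof.
move=> df; have -> : (fun y => \sum_(i | P i) f i y) = \sum_(i | P i) f i.
  by apply/funext => y; rewrite fct_sumE.
elim/big_ind : _ => // ? ? ? ?; exact: differentiableD.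
Qed.

Lemma differentiable_fprod (I : finType) (P : pred I) (f : I -> V -> R) x :
  (forall i, P i -> differentiable (f i) x) ->
  differentiable (fun y => \prod_(i | P i) f i y) x.
Proof.
move=> df; have -> : (fun y => \prod_(i | P i) f i y) = \prod_(i | P i) f i.
  by apply/funext => y; rewrite fct_prodE.
elim/big_ind : _ => // ? ? ? ?; exact: differentiableM.
Qed.

Lemma differentiable_mulmx m n p (F : V -> 'M[R]_(m, n)) (G : V -> 'M[R]_(n, p)) x :
  differentiable F x -> differentiable G x ->
  differentiable (fun y => F y *m G y) x.
Proof.
move=> dF dG; apply: differentiable_mx => i j; under eq_fun do rewrite mxE.
apply: differentiable_fsum => k _.
by apply: differentiableM; apply: differentiable_entry.
Qed.

Lemma differentiable_det n (F : V -> 'M[R]_n) x :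
  differentiable F x -> differentiable (fun y => \det (F y)) x.
Proof.
move=> dF; apply: differentiable_fsum => s _; apply: differentiableM.
  exact: differentiable_cst.
by apply: differentiable_fprod => i _; apply: differentiable_entry.
Qed.

(** The determinant stays nonzero near x, so there the inverse is given by Cramer's formula, which
    is rational in the entries. *)
Lemma differentiable_invmx n (F : V -> 'M[R]_n) x :
  differentiable F x -> F x \in unitmx -> differentiable (fun y => invmx (F y)) x.
Proof.
move=> dF Fx; have ddet := differentiable_det dF.
have Fx0 : \det (F x) != 0 by rewrite -unitfE -unitmxE.
have nearE : \forall y \near x, (\det (F y))^-1 *: \adj (F y) = invmx (F y).
  near=> y; rewrite /invmx unitmxE unitfE ifT//; near: y.
  by apply: cvgr_neq0 Fx0; exact: differentiable_continuous ddet.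
apply: differentiable_near_eq nearE _; apply: differentiable_mx => i j.
under eq_fun do rewrite !mxE; apply: differentiableM.
  exact: differentiableV.
apply: differentiableM; first exact: differentiable_cst.
apply: differentiable_det; apply: differentiable_mx => k l.
by under eq_fun do rewrite !mxE; apply: differentiable_entry.
Unshelve. all: by end_near. Qed.

Lemma derive_mulmx m n p (F : V -> 'M[R]_(m, n)) (G : V -> 'M[R]_(n, p)) x v :
  differentiable F x -> differentiable G x ->
  'D_v (fun y => F y *m G y) x = 'D_v F x *m G x + F x *m 'D_v G x.
Proof.
move=> dF dG; apply/matrixP => i j.
rewrite derive_entry; last exact: differentiable_mulmx.
have -> : (fun y => (F y *m G y) i j) =
    \sum_k ((fun y => F y i k) * (fun y => G y k j)).
  by apply/funext => y; rewrite mxE fct_sumE.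
have dFe k : derivable (fun y => F y i k) x v.
  by apply: diff_derivable; exact: differentiable_entry.
have dGe k : derivable (fun y => G y k j) x v.
  by apply: diff_derivable; exact: differentiable_entry.
rewrite derive_sum => [|k]; last exact: derivableM.
rewrite !mxE -big_split; apply: eq_bigr => k _ /=.
rewrite deriveM// !derive_entry// addrC; congr (_ + _).
by rewrite mulrC.
Qed.

End MatrixValued.

(** * Mean value estimates and symmetry of second derivatives *)

Section PartialDerivatives.
Variable R : realType.

Section Line.
Variables V : normedModType R.

Lemma is_derive_line (f : V -> R) (z v : V) (t : R) :
  derivable f (z + t *: v) v ->
  is_derive t 1 (fun s => f (z + s *: v)) ('D_v f (z + t *: v)).
Proof.
move=> df.
have E : (fun h : R => h^-1 *: (((fun s => f (z + s *: v)) \o shift t) (h *: 1) -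
                                 f (z + t *: v))) =
         (fun h : R => h^-1 *: ((f \o shift (z + t *: v)) (h *: v) -
                                 f (z + t *: v))).
  apply/funext => h /=; congr (_ *: (f _ - _)).
  by rewrite [h%:A]mulr1 scalerDl addrCA.
by split; rewrite /derivable /derive E.
Qed.

(** Bounding t by |d| without recording its direction treats both signs of d at once; the price is a
    larger ball in [lipschitz_partial]. *)
Lemma mvt_line (f : V -> R) (z v : V) (d : R) :
  (forall t : R, `|t| <= `|d| -> derivable f (z + t *: v) v) ->
  exists2 t : R, `|t| <= `|d| & f (z + d *: v) - f z = d * 'D_v f (z + t *: v).
Proof.
move=> df; pose g (s : R) := f (z + s *: v).
have g0 : g 0 = f z by rewrite /g scale0r addr0.
have dg (t : R) : `|t| <= `|d| -> is_derive t 1 g ('D_v f (z + t *: v)).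
  by move=> /df; exact: is_derive_line.
have [d0|d0] := leP 0 d.
  have nd (t : R) : t \in `[0, d] -> `|t| <= `|d|.
    by rewrite in_itv/= => /andP[t0 td]; rewrite !ger0_norm.
  have [|||t td E] := @MVT_segment R g (fun t => 'D_v f (z + t *: v)) 0 d => //.
  - by move=> t td; apply/dg/nd; apply: subset_itv_oo_cc.
  - by apply: derivable_within_continuous => t /nd/dg[].
  by exists t; [exact: nd | rewrite -g0 -/(g d) E subr0 mulrC].
have nd (t : R) : t \in `[d, 0] -> `|t| <= `|d|.
  by rewrite in_itv/= => /andP[td t0]; rewrite !ler0_norm ?lerN2// ltW.
have [|||t td E] := @MVT_segment R g (fun t => 'D_v f (z + t *: v)) d 0.
- exact: ltW.
- by move=> t td; apply/dg/nd; apply: subset_itv_oo_cc.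
- by apply: derivable_within_continuous => t /nd/dg[].
exists t; first exact: nd.
by apply: oppr_inj; rewrite opprB -g0 -/(g d) E sub0r mulrN mulrC.
Qed.

Lemma derive_translate (f : V -> R) (z c v : V) :
  'D_v (fun y => f (y + c)) z = 'D_v f (z + c) /\
  (derivable (fun y => f (y + c)) z v <-> derivable f (z + c) v).
Proof.
have E : (fun h : R => h^-1 *: (((fun y => f (y + c)) \o shift z) (h *: v) -
                                 f (z + c))) =
         (fun h : R => h^-1 *: ((f \o shift (z + c)) (h *: v) - f (z + c))).
  by apply/funext => h /=; rewrite addrA.
by rewrite /derivable /derive E.
Qed.

(** The mean value theorem along a, applied to y |-> f (y + t b) - f y, turns the second difference
    into t times an increment of 'D_a f. Expanding 'D_a f to first order at x, the linear parts
    leave t^2 'D_b ('D_a f) x and only two remainders are to be bounded. *)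
Lemma second_difference (f : V -> R) (x a b : V) :
  (\forall y \near x, derivable f y a) -> differentiable ('D_a f) x ->
  forall e, 0 < e -> \forall t \near (0 : R),
    `|f (x + t *: a + t *: b) - f (x + t *: a) - f (x + t *: b) + f x
      - t ^+ 2 * 'D_b ('D_a f) x| <= e * t ^+ 2.
Proof.
move=> da dD e e0.
(* |t| K bounds the sum of the norms of the increments s a + t b and s a for |s| <= |t|; the summand
   1 keeps K positive. *)
pose K := 2 * `|a| + `|b| + 1.
have K0 : 0 < K by rewrite ltr_pwDr// addr_ge0// mulr_ge0.
have eK : 0 < e / K by rewrite divr_gt0.
have [_ /eqaddoP/(_ _ eK)] := (diff_locallyP x ('D_a f)).1 dD.
move: da; rewrite (near_shift 0 x) subr0 => da.
move=> /(filterI da){da} /nbhs_ballP[r /= r0 rE].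
have {}rE h : `|h| < r -> derivable f (h + x) a /\
    `|'D_a f (h + x) - 'D_a f x - 'd ('D_a f) x h| <= e / K * `|h|.
  move=> hr; have [] := rE h; first by rewrite -ball_normE /= sub0r normrN.
  rewrite /= => ? H; split=> //; apply: le_trans H.
  by rewrite !fctE /= opprD addrA.
near=> t.
have tK : `|t| * K < r.
  rewrite -ltr_pdivlMr//; near: t; apply/nbhs_ballP.
  exists (r / K); first exact: divr_gt0.
  by move=> s; rewrite -ball_normE /= sub0r normrN.
have ltr' (s : R) : `|s| <= `|t| -> `|s *: a| < r /\ `|s *: a + t *: b| < r.
  move=> st; have sa : `|s *: a| <= `|t| * `|a| by rewrite normrZ ler_wpM2r.
  split; apply: le_lt_trans tK.
    apply: (le_trans sa); rewrite ler_wpM2l// /K.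
    by have := normr_ge0 a; have := normr_ge0 b; lra.
  apply: (le_trans (ler_normD _ _)); rewrite normrZ in sa *.
  rewrite normrZ; apply: (le_trans (lerD sa (lexx _))).
  rewrite -mulrDr ler_wpM2l// /K.
  by have := normr_ge0 a; lra.
have [|s st] := @mvt_line (fun y => f (y + t *: b) - f y) x a t.
  move=> s /ltr'[h1 h2]; apply: derivableB; last first.
    by rewrite addrC; exact: (rE _ h1).1.
  apply/(derive_translate _ _ _ _).2.
  by rewrite -addrA addrC; exact: (rE _ h2).1.
rewrite deriveB; first last.
- by have [h1 h2] := ltr' _ st; rewrite addrC; exact: (rE _ h1).1.
- have [h1 h2] := ltr' _ st; apply/(derive_translate _ _ _ _).2.
  by rewrite -addrA addrC; exact: (rE _ h2).1.
rewrite (derive_translate _ _ _ _).1 => E.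
have [h1 h2] := ltr' _ st.
have [_ e1] := rE _ h1; have [_ e2] := rE _ h2.
set p1 := 'D_a f (s *: a + x) in e1; set p2 := 'D_a f (_ + x) in e2.
have p1E : 'D_a f (x + s *: a) = p1 by rewrite addrC.
have p2E : 'D_a f (x + s *: a + t *: b) = p2 by rewrite -addrA addrC.
rewrite p1E p2E in E.
have -> : f (x + t *: a + t *: b) - f (x + t *: a) - f (x + t *: b) + f x =
    t * (p2 - p1) by rewrite -E; ring.
have -> : t * (p2 - p1) - t ^+ 2 * 'D_b ('D_a f) x =
    t * ((p2 - 'D_a f x - 'd ('D_a f) x (s *: a + t *: b))
        - (p1 - 'D_a f x - 'd ('D_a f) x (s *: a))).
  have L : 'd ('D_a f) x (s *: a + t *: b) =
      'd ('D_a f) x (s *: a) + t * 'd ('D_a f) x b.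
    by rewrite linearD; congr (_ + _); rewrite linearZ.
  by rewrite L [in LHS]deriveE//; ring.
rewrite normrM; apply: (@le_trans _ _ (`|t| * (e / K * (`|t| * K)))).
  rewrite ler_wpM2l//; apply: (le_trans (ler_normB _ _)).
  apply: (le_trans (lerD e2 e1)); rewrite -mulrDr ler_wpM2l ?(ltW eK)//.
  apply: (le_trans (lerD (ler_normD _ _) (lexx _))).
  rewrite !normrZ.
  have : `|s| * `|a| <= `|t| * `|a| by rewrite ler_wpM2r.
  by have := normr_ge0 t; rewrite /K; nra.
rewrite (mulrC `|t| K) (mulrA (e / K)) divfK ?gt_eqF// mulrCA -expr2.
by rewrite real_normK// num_real.
Unshelve. all: by end_near. Qed.

(** The second difference is symmetric in a and b, so divided by t^2 it approximates both mixed
    derivatives. *)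
Lemma derive_symmetric (f : V -> R) (x a b : V) :
  (\forall y \near x, derivable f y a) -> (\forall y \near x, derivable f y b) ->
  differentiable ('D_a f) x -> differentiable ('D_b f) x ->
  'D_b ('D_a f) x = 'D_a ('D_b f) x.
Proof.
move=> da db dDa dDb; apply/eqP; rewrite -subr_eq0 -normr_le0.
apply/ler_addgt0Pr => e e0; rewrite add0r.
have e2 : 0 < e / 2 by rewrite divr_gt0.
have S1 := second_difference b da dDa e2; have S2 := second_difference a db dDb e2.
have [t [[A B] t_neq0]] := filter_ex
  (filterI (filterI (nbhs_dnbhs S1) (nbhs_dnbhs S2)) (nbhs_dnbhs_neq (0 : R))).
have t0 : 0 < t ^+ 2 by rewrite exprn_even_gt0.
rewrite -(ler_pM2r t0) -[X in _ * X <= _](gtr0_norm t0) -normrM.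
move: A B; rewrite /= [x + t *: b + t *: a]addrAC.
move: ('D_b ('D_a f) x) ('D_a ('D_b f) x) => p q.
move: (f (x + t *: a + t *: b)) (f (x + t *: a)) (f (x + t *: b)) (f x) (t ^+ 2).
move=> u1 u2 u3 u4 T A B.
have -> : (p - q) * T = (u1 - u3 - u2 + u4 - T * q) - (u1 - u2 - u3 + u4 - T * p).
  by ring.
apply: (le_trans (ler_normB _ _)); rewrite [e]splitr mulrDl.
exact: (lerD B A).
Qed.
End Line.
End PartialDerivatives.

(** * Partial derivatives and twice differentiable functions on R^n *)

Section Coordinates.
Variables (R : realType) (n : nat).
Implicit Types (f : 'rV[R]_n -> R) (x y z : 'rV[R]_n).
Local Notation e i := (basis_vec R i).

Lemma rV_sum_basis x : x = \sum_i x 0 i *: e i.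
Proof. exact: row_sum_delta. Qed.

Lemma rV_norm_entry x i : `|x 0 i| <= `|x|.
Proof.
by rewrite [leRHS]/Num.Def.normr /= mx_normrE; exact: (le_bigmax _ _ (ord0, i)).
Qed.

Lemma rV_norm_le x (c : R) : 0 <= c -> (forall i, `|x 0 i| <= c) -> `|x| <= c.
Proof.
move=> c0 xc; rewrite [leLHS]/Num.Def.normr /= mx_normrE.
by apply: bigmax_le => // -[i j] _; rewrite ord1.
Qed.

Lemma rV_norm_lt x (c : R) : 0 < c -> (forall i, `|x 0 i| < c) -> `|x| < c.
Proof.
move=> c0 xc; rewrite [ltLHS]/Num.Def.normr /= mx_normrE.
by apply: bigmax_lt => // -[i j] _; rewrite ord1.
Qed.

(** Walk from y to x one coordinate at a time; p k has its first k coordinates from x. In the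
    maximum norm, the point supplied by [mvt_line] is displaced by less than 2 r from a point within
    r of a, hence the radius 3 r. *)
Lemma lipschitz_partial f (a : 'rV[R]_n) (r c : R) :
  (forall y, `|y - a| < 3 * r ->
     forall i, derivable f y (e i) /\ `|'D_(e i) f y| <= c) ->
  forall x y, `|x - a| < r -> `|y - a| < r ->
  `|f x - f y| <= n%:R * c * `|x - y|.
Proof.
move=> fc x y xr yr.
have r0 : 0 < r by apply: le_lt_trans xr.
pose p k : 'rV[R]_n := \row_j (if (j < k)%N then x 0 j else y 0 j).
have pn : p n = x by apply/rowP => j; rewrite mxE ltn_ord.
have p0 : p 0%N = y by apply/rowP => j; rewrite mxE.
have -> : f x - f y = \sum_(k < n) (f (p k.+1) - f (p k)).
  rewrite -pn -[in LHS]p0 -(telescope_sumr (fun k => f (p k)) (leq0n n)).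
  by rewrite big_mkord.
apply: (le_trans (ler_norm_sum _ _ _)).
apply: (@le_trans _ _ (\sum_(k < n) c * `|x - y|)); last first.
  by rewrite sumr_const card_ord -[leRHS]mulrA mulr_natl.
apply: ler_sum => k _.
pose d := x 0 k - y 0 k.
have -> : p k.+1 = p k + d *: e k.
  apply/rowP => j; rewrite !mxE eqxx /= ltnS leq_eqVlt.
  have [->|jk] := eqVneq j k.
    by rewrite eqxx ltnn mulr1 /d addrC subrK.
  by rewrite (negPf jk : (j == k :> nat) = false) mulr0 addr0.
have entry (z : 'rV[R]_n) j : `|z - a| < r -> `|z 0 j - a 0 j| < r.
  by apply: le_lt_trans; have := rV_norm_entry (z - a) j; rewrite !mxE.
have dr : `|d| < 2 * r.
  have := entry _ k xr; have := entry _ k yr; rewrite !ltr_norml /d; lra.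
have near_a (t : R) : `|t| <= `|d| -> `|p k + t *: e k - a| < 3 * r.
  move=> td; apply: rV_norm_lt => [|j]; first by rewrite mulr_gt0.
  rewrite !mxE eqxx /=; have [->|jk] := eqVneq j k.
    rewrite ltnn mulr1 addrAC; apply: (le_lt_trans (ler_normD _ _)).
    by have := entry _ k yr; lra.
  rewrite mulr0 addr0; case: ifP => _.
    by have := entry _ j xr; lra.
  by have := entry _ j yr; lra.
have [|t td ->] := @mvt_line R _ f (p k) (e k) d.
  by move=> t /near_a/fc/(_ k)[].
have [_ Dc] := fc _ (near_a _ td) k.
rewrite normrM mulrC ler_pM//.
by have := rV_norm_entry (x - y) k; rewrite !mxE.
Qed.

Lemma diff_partials f x v : differentiable f x ->
  'd f x v = \sum_i v 0 i * 'D_(e i) f x.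
Proof.
move=> df; rewrite [in LHS](rV_sum_basis v) linear_sum; apply: eq_bigr => i _.
by rewrite linearZ deriveE.
Qed.

Lemma derive_partials f x v : differentiable f x ->
  'D_v f x = \sum_i v 0 i * 'D_(e i) f x.
Proof. by move=> df; rewrite deriveE// diff_partials. Qed.

(** If w is the candidate differential, f - w has small partials near x, hence a small Lipschitz
    constant, which is the required little-o estimate. *)
Lemma continuous_partials_differentiable f x :
  (\forall y \near x, forall i, derivable f y (e i)) ->
  (forall i, {for x, continuous ('D_(e i) f)}) ->
  differentiable f x.
Proof.
move=> fder fcont.
pose w (v : 'rV[R]_n) : R := \sum_(i < n) v 0 i * 'D_(e i) f x.
have w_lin : linear w.
  move=> k u v; rewrite /w scaler_sumr -big_split; apply: eq_bigr => i _.
  by rewrite !mxE mulrDl /GRing.scale /= mulrA.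
pose wlM := GRing.isLinear.Build _ _ _ _ w w_lin.
pose wl : {linear 'rV[R]_n -> R} := HB.pack w wlM.
have dw y : differentiable w y.
  apply: differentiable_fsum => i _; apply: differentiableM.
    exact: differentiable_coord.
  exact: differentiable_cst.
have wcont : continuous wl by move=> y; exact: differentiable_continuous (dw y).
have Dw y i : 'D_(e i) w y = 'D_(e i) f x.
  rewrite deriveE// (_ : 'd w y = wl :> (_ -> _)); last exact: (diff_lin y wcont).
  rewrite /= /w (bigD1 i)//= big1 ?addr0 => [|j ji]; rewrite mxE !eqxx/=.
    by rewrite mul1r.
  by rewrite (negPf ji) mul0r.
have fE : f \o shift x = cst (f x) + (wl : 'rV[R]_n -> R) +o_ (0 : 'rV[R]_n) id.
  (* The denominator absorbs the factor n of [lipschitz_partial]; the successor avoids division by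
     0. *)
  apply/eqaddoP => eps eps0; pose c := eps / n.+1%:R.
  have c0 : 0 < c by rewrite divr_gt0.
  have : \forall y \near x, forall i, derivable f y (e i) /\
      `|'D_(e i) f x - 'D_(e i) f y| <= c.
    apply: (@filter_forall _ _ _ (nbhs x)) => i; apply: filterI.
      by move: fder; apply: filterS => y.
    by have /cvgrPdist_le/(_ _ c0) := fcont i.
  move=> /nbhs_ballP[r /= r0 rE].
  have r3 : 0 < r / 3 by rewrite divr_gt0.
  apply/nbhs_ballP; exists (r / 3) => //= h.
  rewrite -ball_normE /= sub0r normrN => hr.
  have := @lipschitz_partial (f \- w) x (r / 3) c _ (h + x) x.
  rewrite addrK subrr normr0 => /(_ _ hr r3) H.
  have -> : (f \o shift x - (cst (f x) + w)) h = (f \- w) (h + x) - (f \- w) x.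
    have wD : w (h + x) = w h + w x by exact: (linearD wl).
    by rewrite !fctE /= wD; ring.
  apply: (le_trans (H _)) => [y yr i|]; last first.
    rewrite ler_wpM2r// /c mulrCA ger_pMr// ler_pdivrMr// mul1r.
    by rewrite ler_nat.
  have [|fd fc] := rE y _ i.
    by rewrite -ball_normE /= distrC; apply: lt_le_trans yr _; rewrite mulrC divfK.
  have wd : derivable w y (e i) by apply: diff_derivable.
  by split; [exact: derivableB | rewrite deriveB// Dw distrC].
by apply/diff_locallyP; rewrite (diff_unique wcont fE); split.
Qed.

Lemma Ck_on1_differentiable U f x : nbhs x U -> Ck_on 1 U f -> differentiable f x.
Proof.
move=> xU [_ fU]; apply: continuous_partials_differentiable.
  by move: xU; apply: filterS => y Uy i; have [+ _] := fU i; apply.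
by move=> i; have [_ [+ _]] := fU i; apply; rewrite inE; exact: nbhs_singleton xU.
Qed.

(** Second-order differentiability at the single point x: no continuity of second partials is asked,
    so composing and inverting maps only needs first-order rules applied to the partials. *)
Definition twice_diff f x :=
  (\forall y \near x, differentiable f y) /\
  forall i, differentiable ('D_(e i) f) x.

Lemma Ck_on2_twice_diff U f x : nbhs x U -> Ck_on 2 U f -> twice_diff f x.
Proof.
move=> xU fU; split=> [|i].
  have := nbhs_interior xU; apply: filterS => y yU.
  apply: (@Ck_on1_differentiable U) => //.
  by have [? fU'] := fU; split=> // i; have [? [? _]] := fU' i.
by apply: (@Ck_on1_differentiable U) => //; have [_ /(_ i)[]] := fU.
Qed.

Lemma twice_diff_near_eq f g x : (\forall y \near x, f y = g y) ->
  twice_diff f x -> twice_diff g x.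
Proof.
move=> fg [df ddf]; have fg' := nbhs_interior fg; split=> [|i].
  near=> y; apply: (@differentiable_near_eq _ _ _ f); near: y; first exact: fg'.
  exact: df.
apply: (@differentiable_near_eq _ _ _ ('D_(e i) f)) => //.
move: fg'; apply: filterS => y; exact: near_eq_derive.
Unshelve. all: by end_near. Qed.

Lemma twice_diff_symmetric f x i j : twice_diff f x ->
  'D_(e i) ('D_(e j) f) x = 'D_(e j) ('D_(e i) f) x.
Proof.
move=> [df ddf]; apply: derive_symmetric => //.
  by move: df; apply: filterS => y; exact: diff_derivable.
by move: df; apply: filterS => y; exact: diff_derivable.
Qed.

End Coordinates.

Lemma near_differentiable_rV (R : realType) (n p : nat)
    (g : 'rV[R]_p -> 'rV[R]_n) (x : 'rV[R]_p) :
  (forall j, twice_diff (fun y => g y 0 j) x) ->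
  \forall y \near x, differentiable g y.
Proof.
move=> tg.
have : \forall y \near x, forall j, differentiable (fun y => g y 0 j) y.
  by apply: (@filter_forall _ _ _ (nbhs x)) => j; have [] := tg j.
apply: filterS => y dgy; apply: differentiable_mx => i j.
by rewrite ord1.
Qed.

(** Near x the chain rule writes each partial of the composite as D, a sum of products of functions
    differentiable at x. *)
Lemma twice_diff_comp (R : realType) (n p : nat) (f : 'rV[R]_n -> R)
    (g : 'rV[R]_p -> 'rV[R]_n) (x : 'rV[R]_p) :
  twice_diff f (g x) -> (forall j, twice_diff (fun y => g y 0 j) x) ->
  twice_diff (f \o g) x.
Proof.
move=> [df ddf] tg.
have dg := near_differentiable_rV tg.
have dgx := nbhs_singleton dg.
have dfg : \forall y \near x, differentiable f (g y).
  exact: differentiable_continuous dgx _ df.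
split; first by near=> y; apply: differentiable_comp; near: y.
move=> i; pose D (y : 'rV[R]_p) : R :=
  \sum_j 'D_(basis_vec R i) (fun y => g y 0 j) y * 'D_(basis_vec R j) f (g y).
apply: (@differentiable_near_eq _ _ _ D).
  near=> y; have dgy : differentiable g y by near: y.
  have dfy : differentiable f (g y) by near: y.
  rewrite deriveE; last exact: differentiable_comp.
  rewrite diff_comp//= diff_partials//; apply: eq_bigr => j _.
  by rewrite -derive_entry// deriveE.
apply: differentiable_fsum => j _; apply: differentiableM.
  by have [_] := tg j.
by apply: (@differentiable_comp _ _ _ _ g ('D_(basis_vec R j) f)).
Unshelve. all: by end_near. Qed.

(* The library does not declare the join of completeness and norm on matrices,
   which Banach's fixed-point theorem needs. *)
HB.instance Definition _ (R : realType) (m n : nat) := Complete.on 'M[R]_(m, n).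

(** * Inverse function theorem at a point with identity derivative *)

Section LocalInverse.
Variables (R : realType) (d : nat) (psi : 'rV[R]_d -> 'rV[R]_d) (x0 : 'rV[R]_d).
Hypothesis psi2 : forall j, twice_diff (fun y => psi y 0 j) x0.
Hypothesis dpsi : forall v, 'd psi x0 v = v.

(** The derivative of [g] vanishes at x0, so [g] is a contraction nearby; solving psi x = y amounts
    to finding a fixed point of x |-> g x + y. *)
Let g x := x - psi x.
Let J y : 'M[R]_d := \matrix_(i, j) 'D_(basis_vec R i) (fun y => psi y 0 j) y.

Let differentiable_J : differentiable J x0.
Proof.
apply: differentiable_mx => i j; under eq_fun do rewrite mxE.
by have [_] := psi2 j.
Qed.

Let psi_near : \forall x \near x0, differentiable psi x.
Proof. exact: near_differentiable_rV psi2. Qed.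

Let diff_psiE x v : differentiable psi x -> 'd psi x v = v *m J x.
Proof.
move=> dx; apply/rowP => j; rewrite -deriveE// derive_entry// derive_partials.
  by rewrite mxE; apply: eq_bigr => i _; rewrite mxE.
exact: differentiable_entry.
Qed.

Let J1 : J x0 = 1%:M.
Proof.
apply/row_matrixP => i; rewrite !rowE mulmx1.
by rewrite -diff_psiE ?dpsi//; exact: nbhs_singleton psi_near.
Qed.

Let local_inverse_radius : exists2 r : R, 0 < r &
  forall x, `|x - x0| < r -> [/\ differentiable psi x, J x \in unitmx &
   forall y, `|y - x0| < r -> `|g x - g y| <= 2^-1 * `|x - y|].
Proof.
(* Chosen so that d * c <= 1/2: c bounds the partials of [g], and [lipschitz_partial] multiplies
   this bound by d. *)
pose c : R := (2 * d.+1%:R)^-1.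
have c0 : 0 < c by rewrite invr_gt0 mulr_gt0.
have dJ := differentiable_continuous differentiable_J.
have Jx0 : \det (J x0) != 0 by rewrite J1 det1 oner_eq0.
have detJ : \forall x \near x0, \det (J x) != 0.
  near=> x; near: x; apply: cvgr_neq0 Jx0.
  exact: differentiable_continuous (differentiable_det differentiable_J).
have nearJ : \forall x \near x0, `|J x0 - J x| <= c.
  by have /cvgrPdist_le/(_ _ c0) := dJ.
have /nbhs_ballP[r /= r0 rE] : \forall x \near x0,
    [/\ differentiable psi x, \det (J x) != 0 & `|J x0 - J x| <= c].
  near=> x; split; near: x; [exact: psi_near | exact: detJ | exact: nearJ].
have {}rE x : `|x - x0| < r ->
    [/\ differentiable psi x, \det (J x) != 0 & `|J x0 - J x| <= c].
  by move=> xr; apply: rE; rewrite -ball_normE /= distrC.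
(* [lipschitz_partial] needs the partials on a ball three times as large. *)
exists (r / 3) => [|x xr]; first exact: divr_gt0.
have lt3 : r / 3 < r by rewrite ltr_pdivrMr// ltr_pMr// ltr1n.
have [dx ux _] := rE _ (lt_trans xr lt3).
split=> // [|y yr]; first by rewrite unitmxE unitfE.
apply: rV_norm_le => [|j]; first by rewrite mulr_ge0.
rewrite !mxE.
apply: (@le_trans _ _ (d%:R * c * `|x - y|)); last first.
  rewrite ler_wpM2r// /c invfM mulrCA ger_pMr ?invr_gt0// ler_pdivrMr// mul1r.
  by rewrite ler_nat.
have := @lipschitz_partial R d (fun y => g y 0 j) x0 (r / 3) c _ x y xr yr.
rewrite !mxE; apply=> z zr i.
have [|dz _ Jz] := rE z; first by apply: lt_le_trans zr _; rewrite mulrC divfK.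
have gE : (fun y => g y 0 j) = (fun y : 'rV[R]_d => y 0 j) - (fun y => psi y 0 j).
  by apply/funext => u; rewrite !mxE.
have d1 : derivable (fun y : 'rV[R]_d => y 0 j) z (basis_vec R i).
  by apply: diff_derivable; exact: differentiable_coord.
have d2 : derivable (fun y => psi y 0 j) z (basis_vec R i).
  by apply: diff_derivable; exact: differentiable_entry.
rewrite gE; split; first exact: derivableB.
rewrite deriveB//; apply: le_trans Jz.
have -> : 'D_(basis_vec R i) (fun y : 'rV[R]_d => y 0 j) z = (J x0) i j.
  rewrite J1 -(derive_entry (F := id))// derive_id !mxE eqxx /=.
  by rewrite eq_sym.
rewrite [leRHS]/Num.Def.normr /= mx_normrE.
have := le_bigmax (0 : R) (fun ij => `|(J x0 - J z) ij.1 ij.2|) (i, j).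
by rewrite /= !mxE.
Unshelve. all: by end_near. Qed.

Lemma local_inverse : exists phi : 'rV[R]_d -> 'rV[R]_d,
  [/\ phi (psi x0) = x0, forall j, twice_diff (fun y => phi y 0 j) (psi x0) &
      \forall y \near psi x0, psi (phi y) = y].
Proof.
have [r r0 rE] := local_inverse_radius.
have r2 : r / 2 < r by rewrite ltr_pdivrMr// ltr_pMr// ltr1n.
have r20 : 0 < r / 2 by rewrite divr_gt0.
have r40 : 0 < r / 4 by rewrite divr_gt0.
have xx0 : `|x0 - x0| < r by rewrite subrr normr0.
(* For y within r / 4 of psi x0, x |-> g x + y preserves U, since half of r / 2 plus r / 4 is r /
   2. *)
pose U := [set x : 'rV[R]_d | `|x - x0| <= r / 2].
have surj y : `|y - psi x0| < r / 4 -> exists x, U x /\ psi x = y.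
  move=> yr; pose T x := g x + y.
  have TU : {homo T : x / U x >-> U x}.
    move=> x xU; rewrite /U /=.
    have -> : T x - x0 = (g x - g x0) + (y - psi x0).
      by rewrite /T /g; apply/rowP => j; rewrite !mxE; ring.
    apply: (le_trans (ler_normD _ _)).
    have [_ _ /(_ _ xx0) gx] := rE x (le_lt_trans xU r2).
    apply: (le_trans (lerD gx (ltW yr))).
    by move: xU; rewrite /U /=; lra.
  have Tfun : isFun _ _ U U T by split.
  pose TF : {fun U >-> U} := HB.pack T Tfun.
  have ctr : is_contraction TF.
    exists (2^-1)%:nng; split; first by rewrite /= invf_lt1// ltr1n.
    move=> [x1 x2] [/= U1 U2].
    have [_ _ /(_ _ (le_lt_trans U2 r2)) H] := rE x1 (le_lt_trans U1 r2).
    by rewrite /T opprD addrACA subrr addr0.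
  have [||x Ux xT] := banach_fixed_point ctr.
  - have -> : U = closed_ball x0 (r / 2).
      rewrite closed_ballE//.
      by apply/seteqP; split => x; rewrite /U /closed_ball_ /= distrC.
    exact: closed_ball_closed.
  - by exists x0; rewrite /U /= subrr normr0 ltW.
  exists x; split=> //; move: xT; rewrite /= /T /g => xT.
  by apply: (addIr (x - psi x)); rewrite (addrC y) -xT addrC subrK.
(* x - y is the sum of the increments of [g] and psi, and the first is at most half of |x - y|. This
   gives uniqueness of preimages and the Lipschitz constant 2 of phi. *)
have inj x y : U x -> U y -> `|x - y| <= 2 * `|psi x - psi y|.
  move=> Ux Uy; have [_ _ /(_ _ (le_lt_trans Uy r2)) H] := rE x (le_lt_trans Ux r2).
  have : `|x - y| <= `|g x - g y| + `|psi x - psi y|.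
    apply: le_trans (ler_normD _ _); rewrite le_eqVlt; apply/orP; left.
    by apply/eqP; congr (`| _ |); rewrite /g; apply/rowP => j; rewrite !mxE; ring.
  by move: H; lra.
pose phi y := get [set x | U x /\ psi x = y].
have phiP y : `|y - psi x0| < r / 4 -> U (phi y) /\ psi (phi y) = y.
  by move=> /surj H; exact: (getPex H).
have phi0 : phi (psi x0) = x0.
  have [|U0 psi0] := phiP (psi x0); first by rewrite subrr normr0.
  apply/eqP; rewrite -subr_eq0 -normr_le0.
  have Ux0 : U x0 by rewrite /U /= subrr normr0 ltW.
  by have := inj _ _ U0 Ux0; rewrite psi0 subrr normr0 mulr0.
have dphi y : `|y - psi x0| < r / 4 ->
    differentiable phi y /\ forall v, 'd phi y v = v *m invmx (J (phi y)).
  move=> yr; have [Ux psix] := phiP y yr.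
  set x := phi y in Ux psix *.
  have [dpx Jx _] := rE x (le_lt_trans Ux r2).
  set B := invmx (J x).
  have Bcont : continuous (mulmxr B : 'rV[R]_d -> 'rV[R]_d).
    move=> u; apply: differentiable_continuous.
    by apply: (differentiable_mulmx (F := id) (G := cst B)).
  have fE : phi \o shift y =
      cst x + (mulmxr B : 'rV[R]_d -> 'rV[R]_d) +o_ (0 : 'rV[R]_d) id.
    have [k k0 kB] := linear_lipschitz Bcont.
    apply/eqaddoP => e e0.
    (* The factor k comes from applying the inverse Jacobian B to the remainder of psi, the factor 2
       from the Lipschitz constant of phi. *)
    have e'0 : 0 < e / (2 * k) by rewrite divr_gt0// mulr_gt0.
    have [_ /eqaddoP/(_ _ e'0)] := (diff_locallyP x psi).1 dpx.
    move=> /nbhs_ballP[del /= del0 delE].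
    have q0 : 0 < r / 4 - `|y - psi x0| by rewrite subr_gt0.
    near=> h.
    have h1 : `|h| < r / 4 - `|y - psi x0|.
      near: h; apply/nbhs_ballP; exists (r / 4 - `|y - psi x0|) => //.
      by move=> h; rewrite -ball_normE /= sub0r normrN.
    have h2 : `|h| < del / 2.
      near: h; apply/nbhs_ballP; exists (del / 2); first exact: divr_gt0.
      by move=> h; rewrite -ball_normE /= sub0r normrN.
    have hyr : `|h + y - psi x0| < r / 4.
      by rewrite -addrA; apply: (le_lt_trans (ler_normD _ _)); lra.
    have [Ux' psix'] := phiP _ hyr.
    set x' := phi (h + y) in Ux' psix'.
    have xx : `|x' - x| <= 2 * `|h|.
      by have := inj _ _ Ux' Ux; rewrite psix psix' addrK.
    have xd : ball 0 del (x' - x).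
      by rewrite -ball_normE /= sub0r normrN; apply: le_lt_trans xx _; lra.
    have := delE _ xd; rewrite !fctE /= subrK psix' psix diff_psiE//.
    have -> : h + y - (y + (x' - x) *m J x) = (h *m B - (x' - x)) *m J x.
      by rewrite [RHS]mulmxBl /B mulmxKV// opprD addrA addrK.
    set u := _ - (x' - x) => uJ.
    rewrite [X in `|X| <= _](_ : _ = - u); last first.
      by rewrite -/x' /u opprB opprD addrA.
    have -> : u = mulmxr B (u *m J x) by rewrite /= /B -mulmxA mulmxV// mulmx1.
    rewrite normrN; apply: (le_trans (kB _)).
    apply: (@le_trans _ _ (k * (e / (2 * k) * (2 * `|h|)))).
      rewrite ler_wpM2l ?(ltW k0)//.
      by apply: (le_trans uJ); rewrite ler_wpM2l// ltW.
    rewrite le_eqVlt; apply/orP; left; apply/eqP; field.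
    by rewrite gt_eqF.
  have df := diff_unique Bcont fE.
  by split=> [|v]; [apply/diff_locallyP; rewrite df | rewrite df].
exists phi; split=> //.
  move=> j; split.
    apply/nbhs_ballP; exists (r / 4) => //= y.
    rewrite -ball_normE /= distrC => /dphi[dy _].
    exact: differentiable_entry.
  move=> i.
  (* Near psi x0 the partials of phi are the entries of the inverse Jacobian at phi y,
     differentiable at psi x0 because J is differentiable at x0. *)
  apply: (@differentiable_near_eq _ _ _ (fun y => (invmx (J (phi y))) i j)).
    apply/nbhs_ballP; exists (r / 4) => //= y.
    rewrite -ball_normE /= distrC => /dphi[dy dyE].
    rewrite -derive_entry// deriveE// dyE /basis_vec -rowE mxE.
    by [].
  have [dphi0 _] : differentiable phi (psi x0) /\ True.
    by split=> //; have [|] := dphi (psi x0); rewrite ?subrr ?normr0.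
  apply: (differentiable_entry (F := fun y => invmx (J (phi y)))).
  apply: (@differentiable_comp _ _ _ _ phi (fun x => invmx (J x))) => //.
  rewrite phi0; apply: differentiable_invmx; first exact: differentiable_J.
  by rewrite J1 unitmx1.
apply/nbhs_ballP; exists (r / 4) => //= y.
by rewrite -ball_normE /= distrC => /phiP[].
Unshelve. all: by end_near. Qed.
End LocalInverse.

(** * The Riemannian Hessian in a chart *)

Lemma row_linear (R : realType) (n : nat) (a : R) (p q r : 'I_n -> R) :
  (forall l, p l = a * q l + r l) ->
  \row_l p l = a *: (\row_l q l) + \row_l r l.
Proof. by move=> pE; apply/rowP => l; rewrite !mxE. Qed.

Lemma bform_koszul_linear (R : realType) (n : nat) (a : R)
    (P1 P2 Q S : 'M[R]_n) (u v w z : 'rV[R]_n) :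
  bform (a *: P1 + P2) w z + bform Q (a *: u + v) z - bform S (a *: u + v) w =
  a * (bform P1 w z + bform Q u z - bform S u w) +
  (bform P2 w z + bform Q v z - bform S v w).
Proof. by rewrite bformD bformZ !bformDl !bformZl; ring. Qed.

Lemma affine_row_linear (R : realType) (n : nat) (a c : R)
    (x y r s : 'rV[R]_n) (B : 'M[R]_n) :
  a *: x + y + c *: (a *: r + s) *m B =
  a *: (x + c *: r *m B) + (y + c *: s *m B).
Proof.
rewrite [c *: _]scalerDr mulmxDl scalerA (mulrC c) -scalerA -scalemxAl.
by rewrite scalerDr addrACA.
Qed.

Lemma bform_sum_basis (R : realType) (n : nat) (A : 'M[R]_n) (u v : 'rV[R]_n) :
  \sum_l bform A u (basis_vec R l) * v 0 l = bform A u v.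
Proof.
rewrite /bform [RHS]mxE; apply: eq_bigr => l _; congr (_ * _); last by rewrite mxE.
by rewrite /basis_vec trmx_delta -colE mxE.
Qed.

Lemma bform_koszul_sum (R : realType) (n : nat) (A B : 'M[R]_n)
    (C : 'I_n -> 'M[R]_n) (u v w : 'rV[R]_n) :
  \sum_l (bform A w (basis_vec R l) + bform B u (basis_vec R l)
          - bform (C l) u w) * v 0 l =
  bform A w v + bform B u v - bform (\sum_l v 0 l *: C l) u w.
Proof.
have -> : bform (\sum_l v 0 l *: C l) u w = \sum_l bform (C l) u w * v 0 l.
  elim/big_rec2: _ => [|l s M _ <-]; first by rewrite /bform mulmx0 mul0mx mxE.
  by rewrite bformD bformZ mulrC.
rewrite -(bform_sum_basis A w v) -(bform_sum_basis B u v) -big_split -sumrB.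
by apply: eq_bigr => l _ /=; rewrite mulrBl mulrDl.
Qed.

(** For A, B, C the derivatives of G along u, v and the gradient w, and c the second-derivative
    term, both sides equal c - (A(w, v) + B(w, u) - C(u, v)) / 2. *)
Lemma bform_koszul_sym (R : realType) (n : nat) (A B C : 'M[R]_n)
    (u v w : 'rV[R]_n) (c : R) :
  A^T = A -> B^T = B -> C^T = C ->
  c - bform A w v + 2^-1 * (bform A w v + bform C u v - bform B u w) =
  c - bform B w u + 2^-1 * (bform B w u + bform C v u - bform A v w).
Proof.
move=> As Bs Cs; rewrite (bformC v u Cs) (bformC u w Bs) (bformC v w As).
by field.
Qed.

Section LocalHessian.
Variables (R : realType) (n : nat) (G : 'rV[R]_n -> 'M[R]_n) (f : 'rV[R]_n -> R).
Variable x : 'rV[R]_n.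
Hypotheses (G_diff : differentiable G x) (G_sym : forall y, (G y)^T = G y).
Hypotheses (G_unit : G x \in unitmx) (f2 : twice_diff f x).

Local Notation e i := (basis_vec R i).
Let W (y : 'rV[R]_n) : 'rV[R]_n := \row_l 'D_(e l) f y.
Let V := local_grad G f.

Let W_diff : differentiable W x.
Proof.
apply: differentiable_mx => i j; under eq_fun do rewrite mxE.
by have [_] := f2.
Qed.

Let V_diff : differentiable V x.
Proof. by apply: differentiable_mulmx => //; exact: differentiable_invmx. Qed.

(** This makes the [linfun] in [hess] agree with the map it is built from. *)
Lemma levi_civita_grad_linear : linear (levi_civita G V x).
Proof.
move=> a u v; rewrite /levi_civita /christoffel.
pose q u l := bform ('D_u G x) (V x) (e l) + bform ('D_(V x) G x) u (e l)
              - bform ('D_(e l) G x) u (V x).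
have q_lin l : q (a *: u + v) l = a * q u l + q v l.
  have DG : 'D_(a *: u + v) G x = a *: 'D_u G x + 'D_v G x.
    by rewrite !deriveE// linearP.
  by rewrite /q DG; exact: bform_koszul_linear.
rewrite -/(q (a *: u + v)) -/(q u) -/(q v) (row_linear q_lin).
have -> : 'D_(a *: u + v) V x = a *: 'D_u V x + 'D_v V x.
  by rewrite !deriveE// linearP.
exact: affine_row_linear.
Qed.

(** Pairing through G x cancels its inverse in [christoffel]; summing over the basis extends
    Koszul's formula from basis vectors to v. *)
Lemma bform_christoffel u w v :
  bform (G x) (christoffel G x u w) v =
  2^-1 * (bform ('D_u G x) w v + bform ('D_w G x) u v - bform ('D_v G x) u w).
Proof.
pose q l := bform ('D_u G x) w (e l) + bform ('D_w G x) u (e l)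
            - bform ('D_(e l) G x) u w.
transitivity (2^-1 * \sum_l q l * v 0 l).
  rewrite /christoffel -/q /bform mulmxKV// -scalemxAl mxE; congr (_ * _).
  by rewrite mxE; apply: eq_bigr => l _; rewrite 2!mxE.
have -> : 'D_v G x = \sum_l v 0 l *: 'D_(e l) G x.
  rewrite deriveE// [v in LHS](rV_sum_basis v) linear_sum.
  by apply: eq_bigr => l _; rewrite linearZ deriveE.
by congr (_ * _); exact: bform_koszul_sum.
Qed.

(** The product rule is applied to W = V *m G, valid near x, which avoids differentiating the
    inverse of G. *)
Lemma bform_derive_grad u v :
  bform (G x) ('D_u V x) v =
  \sum_l \sum_k v 0 l * u 0 k * 'D_(e k) ('D_(e l) f) x - bform ('D_u G x) (V x) v.
Proof.
have nearVG : \forall y \near x, W y = V y *m G y.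
  have Gx0 : \det (G x) != 0 by rewrite -unitfE -unitmxE.
  near=> y; rewrite /V /local_grad mulmxKV// unitmxE unitfE; near: y.
  apply: cvgr_neq0 Gx0.
  exact: differentiable_continuous (differentiable_det G_diff).
have DW : 'D_u W x = 'D_u V x *m G x + V x *m 'D_u G x.
  by rewrite (near_eq_derive _ nearVG) derive_mulmx.
have {}DW : 'D_u V x *m G x = 'D_u W x - V x *m 'D_u G x by rewrite DW addrK.
rewrite /bform DW mulmxBl !mxE; congr (_ - _); apply: eq_bigr => l _.
rewrite derive_entry// mxE.
have -> : (fun y => W y 0 l) = 'D_(e l) f by apply/funext => y; rewrite mxE.
rewrite derive_partials; last by have [_] := f2.
by rewrite mulr_suml; apply: eq_bigr => k _; rewrite mulrC mulrA.
Unshelve. all: by end_near. Qed.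

Lemma levi_civita_grad_sym u v :
  bform (G x) (levi_civita G V x u) v = bform (G x) (levi_civita G V x v) u.
Proof.
have DG_sym a : ('D_a G x)^T = 'D_a G x.
  apply/matrixP => i j; rewrite mxE !derive_entry//; congr ('D_a _ x).
  by apply/funext => y; rewrite -[in LHS]G_sym mxE.
rewrite /levi_civita !bformDl !bform_christoffel !bform_derive_grad.
have -> : \sum_l \sum_k v 0 l * u 0 k * 'D_(e k) ('D_(e l) f) x =
          \sum_l \sum_k u 0 l * v 0 k * 'D_(e k) ('D_(e l) f) x.
  rewrite exchange_big; apply: eq_bigr => l _; apply: eq_bigr => k _.
  by rewrite twice_diff_symmetric// (mulrC (v 0 k)).
by apply: bform_koszul_sym; exact: DG_sym.
Qed.

End LocalHessian.

Lemma linfun_linear (R : realType) (E1 E2 : vectType R) (F : E1 -> E2) :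
  linear F -> linfun F =1 F.
Proof.
move=> F_lin; pose FL := GRing.isLinear.Build _ _ _ _ F F_lin.
pose Fl : {linear E1 -> E2} := HB.pack F FL.
by move=> v; rewrite -[LHS]/(linfun Fl v) lfunE.
Qed.

Section Charts.
Variables (R : realType) (n : nat) (M : topologicalType) (S : manifold R n M).

Lemma chart_img_nbhs p : nbhs (chart S p p) (chart_img S p).
Proof.
apply: open_nbhs_nbhs; split; first exact: chart_img_open.
by exists p => //; exact: chart_dom_center.
Qed.

Lemma chart_invK p x : chart_img S p x -> chart S p (chart_inv S p x) = x.
Proof. by move=> [q qp <-]; rewrite chartK. Qed.

Lemma chart_inv_center p : chart_inv S p (chart S p p) = p.
Proof. by rewrite chartK//; exact: chart_dom_center. Qed.

Lemma chart_inv_cvg p : chart_inv S p x @[x --> chart S p p] --> p.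
Proof.
rewrite -[X in _ --> X](chart_inv_center p); apply: chart_inv_continuous.
by rewrite inE; exact: nbhs_singleton (chart_img_nbhs p).
Qed.

Lemma chart_image_nbhs p (A : set M) : nbhs p A ->
  nbhs (chart S p p) (chart S p @` (chart_dom S p `&` A)).
Proof.
move=> pA; have pD : nbhs p (chart_dom S p `&` A).
  apply: filterI => //; apply: open_nbhs_nbhs; split; first exact: chart_dom_open.
  exact: chart_dom_center.
have U := chart_img_nbhs p; have DA := chart_inv_cvg pD.
near=> x; have xE : chart S p (chart_inv S p x) = x.
  by apply: chart_invK; near: x.
exists (chart_inv S p x) => //; near: x; exact: DA.
Unshelve. all: by end_near. Qed.

Lemma Ck_fun2_twice_diff f p : Ck_fun S 2 f ->
  twice_diff (f \o chart_inv S p) (chart S p p).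
Proof. by move=> f2; apply: Ck_on2_twice_diff (chart_img_nbhs p) (f2 p). Qed.

Variable g : riemannian_metric S.

Lemma gram_unit p : gram g p \in unitmx.
Proof.
rewrite unitmxE unitfE; apply/negP => /det0P[v v0 vG].
by have := gram_pos g p v0; rewrite /bform vG mul0mx mxE ltxx.
Qed.

(** At the centre the transition map goes from the chart at p to itself, so it is locally the
    identity and its Jacobian is 1. *)
Lemma gram_in_center p : gram_in S (gram g) p (chart S p p) = gram g p.
Proof.
rewrite /gram_in chart_inv_center.
have -> : jacobian (chart S p \o chart_inv S p) (chart S p p) = 1%:M.
  have E : \forall y \near chart S p p, y = (chart S p \o chart_inv S p) y.
    by have := chart_img_nbhs p; apply: filterS => y /chart_invK.
  have dE : differentiable (chart S p \o chart_inv S p) (chart S p p).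
    exact: (differentiable_near_eq E).
  apply/row_matrixP => i; rewrite !rowE mulmx1 -deriveEjacobian//.
  by rewrite -(near_eq_derive _ E) derive_id.
by rewrite mul1mx trmx1 mulmx1.
Qed.

Lemma gram_in_sym p x : (gram_in S (gram g) p x)^T = gram_in S (gram g) p x.
Proof. by rewrite /gram_in !trmx_mul trmxK gram_sym mulmxA. Qed.

Lemma gram_in_differentiable p : differentiable (gram_in S (gram g) p) (chart S p p).
Proof.
apply: differentiable_mx => i j.
exact: Ck_on1_differentiable (chart_img_nbhs p) (gram_smooth g p i j 1%N).
Qed.

Lemma inner_product_inner p : inner_product (inner g (p := p)).
Proof.
split=> [w a u v|u v|u u0]; rewrite /inner.
- by rewrite bformDl bformZl.
- by rewrite bformC// gram_sym.
- exact: gram_pos.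
Qed.

Lemma hess_selfadjoint f p (u v : tangent S p) :
  twice_diff (f \o chart_inv S p) (chart S p p) ->
  inner g (hess g f p u) v = inner g u (hess g f p v).
Proof.
move=> f2; have G_diff := gram_in_differentiable p.
have G_unit : gram_in S (gram g) p (chart S p p) \in unitmx.
  by rewrite gram_in_center gram_unit.
rewrite /hess /inner !linfun_linear; [|exact: levi_civita_grad_linear..].
rewrite (bformC u) ?gram_sym// -gram_in_center.
by apply: levi_civita_grad_sym => // y; exact: gram_in_sym.
Qed.

End Charts.

(** * Submersions and the quotient Hessian *)

Section SmoothMaps.
Variables (R : realType) (n1 n2 : nat) (M1 M2 : topologicalType).
Variables (S1 : manifold R n1 M1) (S2 : manifold R n2 M2).
Variables (F : M1 -> M2) (p : M1).
Hypothesis F_smooth : smooth_map S1 S2 F.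

Let Fhat := chart S2 (F p) \o F \o chart_inv S1 p.

Lemma smooth_map_twice_diff j : twice_diff (fun x => Fhat x 0 j) (chart S1 p p).
Proof.
have [F_cont F_Ck] := F_smooth.
apply: Ck_on2_twice_diff (F_Ck p (F p) j 2%N).
apply: chart_image_nbhs; apply: F_cont.
by apply: open_nbhs_nbhs; split; [exact: chart_dom_open | exact: chart_dom_center].
Qed.

Lemma smooth_map_differentiable : differentiable Fhat (chart S1 p p).
Proof.
exact: nbhs_singleton (near_differentiable_rV smooth_map_twice_diff).
Qed.

Lemma smooth_map_center : Fhat (chart S1 p p) = chart S2 (F p) (F p).
Proof. by rewrite /Fhat /= chart_inv_center. Qed.

Lemma smooth_map_near_dom :
  \forall x \near chart S1 p p, chart_dom S2 (F p) (F (chart_inv S1 p x)).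
Proof.
have [F_cont _] := F_smooth.
have pD : nbhs (F p) (chart_dom S2 (F p)).
  by apply: open_nbhs_nbhs; split; [exact: chart_dom_open | exact: chart_dom_center].
have FD : nbhs p (F @^-1` chart_dom S2 (F p)) := F_cont p _ pD.
by have H := @chart_inv_cvg _ _ _ S1 p _ FD; exact: H.
Qed.

Lemma differentialE v : differential S1 S2 F p v = 'd Fhat (chart S1 p p) v.
Proof. by rewrite /differential lfunE. Qed.

Lemma comp_smooth_map_twice_diff (f : M2 -> R) :
  twice_diff (f \o chart_inv S2 (F p)) (chart S2 (F p) (F p)) ->
  twice_diff (f \o F \o chart_inv S1 p) (chart S1 p p).
Proof.
move=> f2; apply: (@twice_diff_near_eq _ _ ((f \o chart_inv S2 (F p)) \o Fhat)).
  by move: smooth_map_near_dom; apply: filterS => x Dx; rewrite /Fhat /= chartK.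
apply: twice_diff_comp; first by rewrite smooth_map_center.
exact: smooth_map_twice_diff.
Qed.

(** F is constant along a curve in the fiber; the chain rule in charts kills its velocity. *)
Lemma tangent_fiber_differential v :
  tangent_set S1 (F @^-1` [set F p]) p v -> differential S1 S2 F p v = 0.
Proof.
move=> [gamma [gamma0 -> gammaP]].
set c := chart S1 p \o gamma.
have c0 : c 0 = chart S1 p p by rewrite /c /= gamma0.
have dc : differentiable c 0.
  apply/derivable1_diffP; have [_ _ /(_ 0%N)] := nbhs_singleton gammaP.
  by rewrite derive1n0.
have FcE : \forall t \near (0 : R),
    (cst (chart S2 (F p) (F p)) : R -> 'rV[R]_n2) t = (Fhat \o c) t.
  move: gammaP; apply: filterS => t [Ft Dt _].
  by rewrite /Fhat /c /= chartK// Ft.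
clearbody c; have dF : differentiable Fhat (c 0).
  by rewrite c0; exact: smooth_map_differentiable.
have := near_eq_derive (1 : R) FcE.
rewrite derive_cst deriveE; last exact: differentiable_comp.
rewrite diff_comp//= => dF0.
rewrite differentialE (derive1E' dc).
by rewrite c0 in dF0.
Qed.

(* An affine right inverse s of the derivative turns the chart representation
   of F into a map with identity derivative; its local inverse phi makes
   s \o phi a local section of F, through which h factors as (h \o F). *)
Lemma submersion_twice_diff (h : M2 -> R) :
  limg (differential S1 S2 F p) = fullv ->
  twice_diff (h \o F \o chart_inv S1 p) (chart S1 p p) ->
  twice_diff (h \o chart_inv S2 (F p)) (chart S2 (F p) (F p)).
Proof.
move=> F_sub hF2; set x0 := chart S1 p p; set y0 := chart S2 (F p) (F p).
pose Q : 'M[R]_(n2, n1) := lin1_mx ((differential S1 S2 F p)^-1)%VF.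
pose s (y : 'rV[R]_n2) : 'rV[R]_n1 := x0 + (y - y0) *m Q.
have s0 : s y0 = x0 by rewrite /s subrr mul0mx addr0.
have sub_diff (y : 'rV[R]_n2) : differentiable (fun z : 'rV[R]_n2 => z - y0) y.
  by apply: (@differentiableB _ _ _ id (cst y0)).
have mul_diff y : differentiable (fun z : 'rV[R]_n2 => (z - y0) *m Q) y.
  by apply: (differentiable_mulmx (G := cst Q)).
have s_diff y : differentiable s y.
  by apply: (@differentiableD _ _ _ (cst x0) (fun z => (z - y0) *m Q)).
have Ds y v : 'D_v s y = v *m Q.
  have -> : 'D_v s y = 'D_v (cst x0) y + 'D_v (fun z : 'rV[R]_n2 => (z - y0) *m Q) y.
    by apply: (@deriveD _ _ _ (cst x0)) => //; exact: diff_derivable.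
  rewrite derive_cst add0r (derive_mulmx (G := cst Q))// derive_cst mulmx0 addr0.
  have -> : 'D_v (fun z => z - y0) y = 'D_v id y - 'D_v (cst y0) y.
    by apply: (@deriveB _ _ _ id (cst y0)) => //; exact: diff_derivable.
  by rewrite derive_id derive_cst subr0.
have s2 j : twice_diff (fun y => s y 0 j) y0.
  split=> [|i]; first by near=> y; exact: differentiable_entry.
  have -> : 'D_(basis_vec R i) (fun y => s y 0 j) = cst ((basis_vec R i *m Q) 0 j).
    by apply/funext => y; rewrite -derive_entry// Ds.
  exact: differentiable_cst.
pose psi := Fhat \o s.
have psi0 : psi y0 = y0 by rewrite /psi /= s0 smooth_map_center.
have psi2 j : twice_diff (fun y => psi y 0 j) y0.
  apply: (@twice_diff_comp _ _ _ (fun x => Fhat x 0 j) s) => //.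
  by rewrite s0; exact: smooth_map_twice_diff.
have dpsi v : 'd psi y0 v = v.
  rewrite diff_comp//=; last by rewrite s0; exact: smooth_map_differentiable.
  rewrite -(@deriveE _ _ _ s y0 v (s_diff y0)) Ds s0.
  rewrite -differentialE mul_rV_lin1 limg_lfunVK//.
  by rewrite F_sub memvf.
have [phi [phi0 phi2 phiK]] := local_inverse psi2 dpsi.
rewrite psi0 in phi0 phi2 phiK.
have phi_diff := nbhs_singleton (near_differentiable_rV phi2).
apply: (@twice_diff_near_eq _ _ ((h \o F \o chart_inv S1 p) \o (s \o phi))); last first.
  apply: twice_diff_comp => [|j]; first by rewrite /= phi0 s0.
  by apply: (@twice_diff_comp _ _ _ (fun y => s y 0 j) phi) => //; rewrite phi0.
have dom : \forall y \near y0, chart_dom S2 (F p) (F (chart_inv S1 p (s (phi y)))).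
  have sphi : {for y0, continuous (s \o phi)}.
    by apply: differentiable_continuous; apply: differentiable_comp.
  have D : nbhs ((s \o phi) y0) [set x | chart_dom S2 (F p) (F (chart_inv S1 p x))].
    by rewrite /= phi0 s0; exact: smooth_map_near_dom.
  exact: sphi _ D.
near=> y.
have yE : psi (phi y) = y by near: y; exact: phiK.
(* Writing y as psi (phi y) exposes the chart at F p evaluated at a point of its domain, where
   [chart_inv] undoes it. *)
rewrite /= -[in RHS]yE /psi /Fhat /= chartK//; near: y; exact: dom.
Unshelve. all: by end_near. Qed.

End SmoothMaps.

(** * Horizontal lifts and the lifted Hessian *)

Section HorizontalLift.
Variables (R : realType) (d n : nat) (T U : topologicalType) (l : T -> U).
Variables (S : manifold R n T) (Sq : manifold R d (fiber_quotient l)).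
Hypothesis pi_sub : submersion S Sq (quotient_map l).
Variables (Z : T) (H : {vspace tangent S Z}).
Hypotheses (H_hor : is_horizontal l H) (H_dim : \dim H = d).

Lemma dpi_horE u :
  dpi_hor Sq H u = differential S Sq (quotient_map l) Z (vsval u).
Proof. by rewrite /dpi_hor comp_lfunE [linfun vsval _]lfunE. Qed.

(** Any preimage v under the differential can be replaced by its horizontal part, because the
    vertical part is sent to 0. *)
Lemma limg_dpi_hor : limg (dpi_hor Sq H) = fullv.
Proof.
have [pi_smooth /(_ Z) pi_full] := pi_sub; have [decomp _] := H_hor.
apply/vspaceP => w; rewrite memvf.
have : w \in limg (differential S Sq (quotient_map l) Z) by rewrite pi_full memvf.
move=> /memv_imgP[v _ ->]; have [v' v'_vert Hv] := decomp v.
apply/memv_imgP; exists (Subvs Hv); first exact: memvf.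
rewrite dpi_horE /= linearB /= (tangent_fiber_differential pi_smooth v'_vert).
by rewrite subr0.
Qed.

Lemma dim_subvs (E : vectType R) (W : {vspace E}) : \dim {: subvs_of W} = \dim W.
Proof. by rewrite dimvf. Qed.

(** A surjection between spaces of the same dimension d has trivial kernel. *)
Lemma dpi_horK : cancel (dpi_hor Sq H) (hor_lift Sq H).
Proof.
apply: lker0_lfunK; rewrite -dimv_eq0.
have := limg_ker_dim (dpi_hor Sq H) fullv.
rewrite limg_dpi_hor capfv dim_subvs H_dim.
have -> : \dim {: tangent Sq (quotient_map l Z)} = d.
  by rewrite dimvf /= /dim /= mul1n.
by move=> /eqP; rewrite -[X in _ == X]add0n eqn_add2r.
Qed.

End HorizontalLift.

Section LiftedHessian.
Variables (R : realType) (d n : nat) (T U : topologicalType) (l : T -> U).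
Variables (S : manifold R n T) (Sq : manifold R d (fiber_quotient l)).
Hypothesis pi_sub : submersion S Sq (quotient_map l).
Variables (Z : T) (H : {vspace tangent S Z}).
Hypotheses (H_hor : is_horizontal l H) (H_dim : \dim H = d).
Variables (g : riemannian_metric S) (gq : riemannian_metric Sq).
Hypothesis gqE : forall eta theta : tangent Sq (quotient_map l Z),
  inner gq eta theta =
  inner g (vsval (hor_lift Sq H eta)) (vsval (hor_lift Sq H theta)).

Let b (u v : subvs_of H) := inner g (vsval u) (vsval v).

Lemma inner_product_subvs : inner_product b.
Proof.
have [lin sym pos] := inner_product_inner g Z.
split=> [w a u v|u v|u u0]; rewrite /b; [by rewrite linearP lin | exact: sym |].
by apply: pos; apply: contra u0 => /eqP u0; apply/eqP/val_inj.
Qed.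

Lemma lifted_hess_formE h u v :
  lifted_hess_form gq h u v = b (lifted_hess H gq h u) v.
Proof.
rewrite /lifted_hess_form /hess_form gqE (dpi_horK pi_sub H_hor H_dim).
by rewrite /b /lifted_hess !comp_lfunE.
Qed.

(** By [lifted_hess_formE] the symmetry is that of the Hessian form of h on the quotient, so no
    computation with lifts is needed. *)
Lemma lifted_hess_selfadjoint h u v :
  twice_diff (h \o chart_inv Sq (quotient_map l Z))
    (chart Sq (quotient_map l Z) (quotient_map l Z)) ->
  b (lifted_hess H gq h u) v = b u (lifted_hess H gq h v).
Proof.
move=> h2; have [_ sym _] := inner_product_subvs.
rewrite [RHS]sym -!lifted_hess_formE /lifted_hess_form /hess_form.
rewrite hess_selfadjoint//; have [_ symq _] := inner_product_inner gq (quotient_map l Z).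
exact: symq.
Qed.

End LiftedHessian.

Theorem theorem2 (R : realType) (n d m : nat)
  (* the ambient Riemannian manifold *)
  (N : topologicalType) (SN : manifold R n N) (gN : riemannian_metric SN)
  (* the embedded Riemannian submanifold *)
  (Me : topologicalType) (Se : manifold R d Me) (ge : riemannian_metric Se)
  (iota : Me -> N) (h_iota : embedding Se SN iota)
  (h_ge : forall (X : Me) (xi eta : tangent Se X),
     inner ge xi eta =
     inner gN (differential Se SN iota X xi) (differential Se SN iota X eta))
  (F : N -> R) (f : Me -> R) (h_F : f = F \o iota) (h_f : Ck_fun Se 2 f)
  (* the total space of the quotient *)
  (Mbar : topologicalType) (Sbar : manifold R (d + m) Mbar)
  (gbar : riemannian_metric Sbar)
  (ell : Mbar -> Me) (h_ell : submersion Sbar Se ell)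
  (h_ell_surj : forall X, exists Z, ell Z = X)
  (* the quotient manifold, the induced function and the horizontal spaces *)
  (Sq : manifold R d (fiber_quotient ell))
  (h_pi : submersion Sbar Sq (quotient_map ell))
  (h : fiber_quotient ell -> R)
  (h_h : forall Z, h (quotient_map ell Z) = (f \o ell) Z)
  (H : forall Z : Mbar, {vspace tangent Sbar Z})
  (h_H : forall Z, is_horizontal ell (H Z))
  (* the quotient metric *)
  (gq : riemannian_metric Sq)
  (h_gq : forall (Z : Mbar) (eta theta : tangent Sq (quotient_map ell Z)),
     inner gq eta theta =
     inner gbar (vsval (hor_lift Sq (H Z) eta)) (vsval (hor_lift Sq (H Z) theta)))
  (X : Me) (Z : Mbar)
  (h_dimX : \dim {: tangent Se X} = d) (h_dimZ : \dim (H Z) = d) :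
  [/\ size (eigenvalues (hess ge f X)) = d,
      size (eigenvalues (lifted_hess (H Z) gq h)) = d &
      forall (L : 'Hom(subvs_of (H Z), tangent Se X)) (alpha beta : R),
        bijective L ->
        (forall theta : subvs_of (H Z),
           lifted_hess_form gq h theta theta =
           hess_form ge f (L theta) (L theta)) ->
        0 <= alpha -> alpha <= beta ->
        (forall theta : subvs_of (H Z),
           alpha * inner gbar (vsval theta) (vsval theta)
             <= inner ge (L theta) (L theta)
             <= beta * inner gbar (vsval theta) (vsval theta)) ->
        forall k : nat, (1 <= k <= d)%N ->
          sandwiched (kth_eigenvalue k (lifted_hess (H Z) gq h))
                     (alpha * kth_eigenvalue k (hess ge f X))
                     (beta * kth_eigenvalue k (hess ge f X))].
Proof.
have h2 : twice_diff (h \o chart_inv Sq (quotient_map ell Z))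
    (chart Sq (quotient_map ell Z) (quotient_map ell Z)).
  apply: (submersion_twice_diff (S1 := Sbar)); [exact: h_pi.1 | exact: h_pi.2 |].
  have -> : h \o quotient_map ell = f \o ell by apply/funext => z; exact: h_h.
  apply: (comp_smooth_map_twice_diff (S2 := Se)); first exact: h_ell.1.
  exact: Ck_fun2_twice_diff.
have fX2 := Ck_fun2_twice_diff X h_f.
have ip1 := inner_product_subvs (H Z) gbar.
have ip2 := inner_product_inner ge X.
have sa1 := lifted_hess_selfadjoint h_pi (h_H Z) h_dimZ (h_gq Z) _ _ h2.
have sa2 (u v : tangent Se X) := hess_selfadjoint ge u v fX2.
have dim1 : \dim {: subvs_of (H Z)} = d by rewrite dim_subvs.
split=> [||L alpha beta _ hL _ _ bnd k kd].
- by rewrite (size_eigenvalues_selfadjoint ip2 sa2).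
- by rewrite (size_eigenvalues_selfadjoint ip1 sa1).
apply: (kth_eigenvalue_sandwich ip1 ip2 sa1 sa2 (L := L)) => //.
- by rewrite dim1 h_dimX.
- by move=> u; rewrite -(lifted_hess_formE h_pi (h_H Z) h_dimZ (h_gq Z)) hL.
- by rewrite dim1.
Qed.
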